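(* Let $S\subset\{1,\dots,n\}$ be a set of indices of cardinality $s$ and suppose that $\mathbf{x}\in\mathbb{C}^n$ is an $s$-sparse vector supported on $S$. Fix $\varepsilon\in(0,1)$. Suppose that the sampling matrix is $$\mathbf{A}=\frac{1}{\sqrt m}\begin{pmatrix}\mathbf{B}_1\\ \vdots\\ \mathbf{B}_m\end{pmatrix},$$ where $\mathbf{B}_1,\dots,\mathbf{B}_m$ are i.i.d. copies of a random matrix $\mathbf{B}$ satisfying the isotropy condition $\mathbb{E}(\mathbf{B}^*\mathbf{B})=\mathrm{Id}$. Suppose that the bounds defining $\mu_1(S),\mu_2(S),\mu_3(S)$ hold deterministically, and let $\gamma(S)=\max_{1\le i\le 3}\mu_i(S)$ (see context). If the number of blocks $m$ satisfies $$m\ \ge\ c\,\gamma(S)\,\log(4n)\,\log(12\varepsilon^{-1}),$$ then, with probability at least $1-\varepsilon$, $\mathbf{x}$ is the unique solution of $$\min_{\mathbf{z}\in\mathbb{C}^n}\|\mathbf{z}\|_1\quad\text{subject to}\quad \mathbf{A}\mathbf{z}=\mathbf{y},\qquad\text{where }\mathbf{y}=\mathbf{A}\mathbf{x}.$$ The constant $c$ can be taken equal to $3\times 534$.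
   Context: $\mathbf{B}$ is a random complex matrix with $n$ columns (the number of rows may be a fixed integer $p\ge 1$, but this is not necessary); $\mathrm{Id}$ is the $n\times n$ identity; $\mathbf{e}_i$ is the $i$-th canonical basis vector of $\mathbb{C}^n$; $\mathbf{M}^*$ is the conjugate transpose. For $S\subset\{1,\dots,n\}$ of cardinality $s$, $P_S\in\mathbb{C}^{n\times s}$ is the matrix with columns $(\mathbf{e}_i)_{i\in S}$, $\mathbf{B}_S=\mathbf{B}P_S$ (restriction to the columns indexed by $S$), and $S^c$ is the complement of $S$ in $\{1,\dots,n\}$. $\|\cdot\|_{2\to2}$ is the spectral operator norm, $\|\mathbf z\|_1=\sum_i|z_i|$. $(\mu_i(S))_{1\le i\le 3}$ denote the smallest positive reals such that $$\|\mathbf{B}_S^*\mathbf{B}_S\|_{2\to2}\le\mu_1(S),\qquad \sqrt{s}\,\max_{i\in S^c}\|\mathbf{B}_S^*\mathbf{B}\mathbf{e}_i\|_2\le\mu_2(S),\qquad s\,\max_{i\in S^c}\big\|\mathbb{E}\big[\mathbf{B}_S^*(\mathbf{B}\mathbf{e}_i)(\mathbf{B}\mathbf{e}_i)^*\mathbf{B}_S\big]\big\|_{2\to2}\le\mu_3(S).$$ ''The bounds hold deterministically'' means that these inequalities hold almost surely. *)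

(* Defs.v *)
From HB Require Import structures.
From mathcomp Require Import all_boot all_order all_algebra.
From mathcomp Require Import complex.
From mathcomp Require Import all_classical all_reals all_analysis.

Set Implicit Arguments.
Unset Strict Implicit.
Unset Printing Implicit Defensive.

Import Order.TTheory GRing.Theory Num.Theory.
Import numFieldNormedType.Exports.

Local Open Scope classical_set_scope.
Local Open Scope ring_scope.
Local Open Scope complex_scope.
Local Open Scope sesquilinear_scope.

Section norms.
Context {R : realType}.

Definition l1norm n (z : 'cV[R[i]]_n) : R := \sum_i Normc.normc (z i 0).

Definition l2norm n (z : 'cV[R[i]]_n) : R :=
  Num.sqrt (\sum_i Normc.normc (z i 0) ^+ 2).

Definition opnorm p q (M : 'M[R[i]]_(p, q)) : R :=
  sup [set l2norm (M *m z) | z in [set z : 'cV[R[i]]_q | l2norm z <= 1]].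

End norms.

(** Complex matrices with [n] columns and an arbitrary, not fixed, number of
    rows: the blocks drawn at random may differ in height.  For [b : blocks R n],
    [tag b] is the number of rows and [tagged b] is the matrix. *)
Definition blocks (R : realType) (n : nat) : Type :=
  {p : nat & 'M[R[i]]_(p, n)}.

HB.instance Definition _ (R : realType) n := Choice.on (blocks R n).
HB.instance Definition _ (R : realType) n :=
  isPointed.Build (blocks R n) 
    (existT (fun p => 'M[R[i]]_(p, n)) 0%N (const_mx 0)).

(** Closed lower orthants of [C^(p x n) = R^(2 p n)], for all [p]. They generate
    the sigma-algebra of the disjoint union over [p] of the Borel spaces
    [C^(p x n)]. *)
Definition block_orthants (R : realType) (n : nat) : set (set (blocks R n)) :=
  [set E | exists p (a b : 'M[R]_(p, n)),
    E = [set existT (fun p => 'M[R[i]]_(p, n)) p M | M in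
          [set M : 'M[R[i]]_(p, n) | forall k j,
            complex.Re (M k j) <= a k j /\ complex.Im (M k j) <= b k j]]].

Notation blockType R n := (g_sigma_algebraType (@block_orthants R n)).

Definition block_height {R : realType} {n} (b : blockType R n) : nat :=
  @tag nat (fun p => 'M[R[i]]_(p, n)) b.

Definition block_val {R : realType} {n} (b : blockType R n) :
    'M[R[i]]_(block_height b, n) :=
  @tagged nat (fun p => 'M[R[i]]_(p, n)) b.

(** For [m = 0] the scalar is [0^-1 = 0] and the matrix has no row. *)
Definition sampling_mx {R : realType} {n} m (b : 'I_m -> blockType R n) :
    'M[R[i]]_(\sum_(k < m) block_height (b k), n) :=
  ((Num.sqrt m%:R)^-1)%:C *: \mxcol_(k < m) block_val (b k).

Section probability.
Context {R : realType}.

(** In the uses below the entries are integrable, so [fine] loses nothing: in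
    the isotropy condition the diagonal entries of [B^* B] are nonnegative with
    [fine] of their integral equal to 1, and they dominate the other entries;
    in the definition of [mu_3] the entries are bounded almost surely because
    of [mu_2]. *)
Definition expect_mx d (T : measurableType d) (P : probability T R) p q
    (X : T -> 'M[R[i]]_(p, q)) : 'M[R[i]]_(p, q) :=
  \matrix_(k, l) (fine 'E_P[fun w => complex.Re (X w k l)] +i*
                  fine 'E_P[fun w => complex.Im (X w k l)]).

(** The product rule for subfamilies follows by taking [E k = setT] for the
    remaining indices. *)
Definition mutually_independent d (T : measurableType d)
    (P : probability T R) d' (U : measurableType d') m
    (X : 'I_m -> {RV P >-> U}) : Prop :=
  forall E : 'I_m -> set U, (forall k, measurable (E k)) ->
    P (\bigcap_(k in [set: 'I_m]) X k @^-1` E k) =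
    (\prod_(k < m) P (X k @^-1` E k))%E.

Definition same_distribution d (T : measurableType d) (P : probability T R)
    d0 (T0 : measurableType d0) (P0 : probability T0 R)
    d' (U : measurableType d') (X : {RV P >-> U}) (X0 : {RV P0 >-> U}) : Prop :=
  forall E : set U, measurable E ->
    distribution P X E = distribution P0 X0 E.

Definition iid_copies d (T : measurableType d) (P : probability T R)
    d0 (T0 : measurableType d0) (P0 : probability T0 R)
    d' (U : measurableType d') m
    (X : 'I_m -> {RV P >-> U}) (X0 : {RV P0 >-> U}) : Prop :=
  mutually_independent X /\ forall k, same_distribution (X k) X0.

(** Stated through a measurable event on which [Q] holds, because a measure is
    meaningless on a set that is not known to be measurable. *)
Definition with_probability_ge d (T : measurableType d) (P : probability T R)
    (r : R) (Q : T -> Prop) : Prop :=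
  exists E : set T,
    [/\ measurable E, (r%:E <= P E)%E & forall w, E w -> Q w].

End probability.

Section coherence.
Context {R : realType} {n : nat}.

Definition canon_vec (i : 'I_n) : 'cV[R[i]]_n := delta_mx i 0.

(** The columns are the [e_i] for [i] in [S], in increasing order of [i]. *)
Definition support_mx (S : {set 'I_n}) : 'M[R[i]]_(n, #|S|) :=
  \matrix_(i < n, k < #|S|) canon_vec (enum_val k) i 0.

Definition restr_mx p (B : 'M[R[i]]_(p, n)) (S : {set 'I_n}) :
    'M[R[i]]_(p, #|S|) := B *m support_mx S.

(** Nonnegative rather than strictly positive reals: an essential supremum may
    vanish (e.g. if [S] is everything), and there is no least strictly positive
    upper bound then. *)
Definition is_least_nonneg (Q : R -> Prop) (mu : R) : Prop :=
  [/\ 0 <= mu, Q mu & forall nu, 0 <= nu -> Q nu -> mu <= nu].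

Context d (T : measurableType d) (P : probability T R).
Variables (B : {RV P >-> blockType R n}) (S : {set 'I_n}).

Let BS (w : T) := restr_mx (block_val (B w)) S.
Let Be (w : T) (i : 'I_n) := block_val (B w) *m canon_vec i.

Definition isotropic : Prop :=
  expect_mx P (fun w => (block_val (B w)) ^t* *m block_val (B w)) = 1%:M.

Definition is_mu1 : R -> Prop := is_least_nonneg (fun mu =>
  \forall w \ae P, opnorm ((BS w) ^t* *m BS w) <= mu).

Definition is_mu2 : R -> Prop := is_least_nonneg (fun mu =>
  \forall w \ae P,
    Num.sqrt #|S|%:R *
      \big[Num.max/0]_(i in ~: S) l2norm ((BS w) ^t* *m Be w i) <= mu).

Definition is_mu3 : R -> Prop := is_least_nonneg (fun mu =>
  #|S|%:R * \big[Num.max/0]_(i in ~: S)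
    opnorm (expect_mx P (fun w =>
      (BS w) ^t* *m Be w i *m (Be w i) ^t* *m BS w)) <= mu).

End coherence.

Definition supported_on {R : realType} n (S : {set 'I_n})
    (x : 'cV[R[i]]_n) : Prop :=
  forall i, i \notin S -> x i 0 = 0.

Definition is_l1_solution {R : realType} p n (A : 'M[R[i]]_(p, n))
    (y : 'cV[R[i]]_p) (z : 'cV[R[i]]_n) : Prop :=
  A *m z = y /\ forall z', A *m z' = y -> l1norm z <= l1norm z'.

Definition is_unique_l1_solution {R : realType} p n (A : 'M[R[i]]_(p, n))
    (y : 'cV[R[i]]_p) (x : 'cV[R[i]]_n) : Prop :=
  is_l1_solution A y x /\ forall z, is_l1_solution A y z -> z = x.

(* Main.v *)
(** A vector [x] supported on [S] is the unique minimiser as soon as a vector [u] in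
    the row space of [A] is close to the sign vector of [x] on [S] and has entries
    bounded away from 1 outside [S], the discrepancy on [S] being negligible with
    respect to a quantitative injectivity bound for [A_S].

    Such a [u] is built by a golfing scheme that uses one block at a time:
    [u' = u + eta B^* B v], where [v] is the residual on [S]. Since [eta] times
    [||B_S^* B_S||] is at most 1, each step multiplies [v] by the contraction
    [Id - eta B_S^* B_S]; the product [Q] of these contractions also witnesses that
    [A_S] is injective, because [Id - Q^*] is a sum of terms [Q_k^* eta B_S^* B_S]
    and [B_S h_S = - B_(S^c) h_(S^c)] for [h] in the kernel of [A]. Second moments
    suffice to make the Frobenius norm of [Q] a high power of [eps / n], so no
    matrix concentration inequality is needed. The entries of [u] outside [S] are
    martingales, controlled by an exponential supermartingale. The step size
    depends on the current residual,
    [eta = 1 / (gamma (2 + K ||v|| / sqrt s))], which makes a number of blocks of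
    order [gamma log (n / eps)] sufficient. *)

From HB Require Import structures.
Require Import Defs.
From mathcomp Require Import all_boot all_order all_algebra.
From mathcomp Require Import complex ring lra.
From mathcomp Require Import all_classical all_reals all_analysis.
From mathcomp Require Import measurable_realfun.

Set Implicit Arguments.
Unset Strict Implicit.
Unset Printing Implicit Defensive.

Import Order.TTheory GRing.Theory Num.Theory.
Import numFieldNormedType.Exports.
Local Open Scope classical_set_scope.
Local Open Scope ring_scope.
Local Open Scope complex_scope.
Local Open Scope sesquilinear_scope.

(** No fixed step size is good enough. With a step of order [1 / gamma] the first increments of [u]
    outside [S] can be of order 1, too large for an exponential tail at level [eps / n]. With a step
    of order [1 / (gamma K)], where [K] is of order [log (n / eps)], the tails are right, but every
    constant factor gained on the residual costs [gamma K] blocks, hence a squared logarithm in all.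
    With the adaptive step, [y = ||v|| / sqrt s] decreases on average at a rate of order
    [y / (gamma (2 + K y))]: about [gamma K] blocks until [y] is of order [1 / K], then [gamma]
    blocks per constant factor. The two costs add up instead of multiplying. The parameters are tied
    to [Lam = ln (4 n) + ln (12 / eps)], for which [exp (- Lam) = q = eps / (48 n)]. An entry of [u]
    outside [S] passes 1/2 in a given direction with probability at most [exp (- K / 128)], whence
    [K = 128 Lam]. The assumption on [m] has the product of the two logarithms where the argument
    needs only their sum. *)

(** * Complex columns as a real Euclidean space; Frobenius and operator norms *)

Section real_inner_product.
Context {R : realType}.
Implicit Types (p q : nat) (r : R).
Local Notation C := R[i].

Lemma re_add (x y : C) : complex.Re (x + y) = complex.Re x + complex.Re y.
Proof. by case: x y => a b [c e]. Qed.
Lemma im_add (x y : C) : complex.Im (x + y) = complex.Im x + complex.Im y.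
Proof. by case: x y => a b [c e]. Qed.
Lemma re_opp (x : C) : complex.Re (- x) = - complex.Re x.
Proof. by case: x. Qed.
Lemma im_opp (x : C) : complex.Im (- x) = - complex.Im x.
Proof. by case: x. Qed.
Lemma re_mul (x y : C) : complex.Re (x * y) =
  complex.Re x * complex.Re y - complex.Im x * complex.Im y.
Proof. by case: x y => a b [c e]. Qed.
Lemma im_mul (x y : C) : complex.Im (x * y) =
  complex.Re x * complex.Im y + complex.Im x * complex.Re y.
Proof. by case: x y => a b [c e]. Qed.
Lemma re_conj (x : C) : complex.Re (Num.conj x) = complex.Re x.
Proof. by case: x. Qed.
Lemma im_conj (x : C) : complex.Im (Num.conj x) = - complex.Im x.
Proof. by case: x. Qed.
Lemma re_sum (I : Type) (s : seq I) (P : pred I) (F : I -> C) :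
  complex.Re (\sum_(i <- s | P i) F i) = \sum_(i <- s | P i) complex.Re (F i).
Proof. by apply: (big_morph (@complex.Re R) re_add). Qed.
Lemma im_sum (I : Type) (s : seq I) (P : pred I) (F : I -> C) :
  complex.Im (\sum_(i <- s | P i) F i) = \sum_(i <- s | P i) complex.Im (F i).
Proof. by apply: (big_morph (@complex.Im R) im_add). Qed.

Lemma normc_sqr (x : C) :
  Normc.normc x ^+ 2 = complex.Re x ^+ 2 + complex.Im x ^+ 2.
Proof. by case: x => a b /=; rewrite sqr_sqrtr// addr_ge0 ?sqr_ge0. Qed.

Lemma normc_ge0 (x : C) : 0 <= Normc.normc x.
Proof. by case: x => a b /=; exact: sqrtr_ge0. Qed.

(** Real part of the Hermitian product: [C^p] is handled as a real Euclidean
    space. *)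
Definition rdot p (a b : 'cV[C]_p) : R :=
  \sum_k (complex.Re (a k 0) * complex.Re (b k 0) +
          complex.Im (a k 0) * complex.Im (b k 0)).

Lemma rdotC p (a b : 'cV[C]_p) : rdot a b = rdot b a.
Proof. by apply: eq_bigr => k _; ring. Qed.

Lemma rdotDr p (a b c : 'cV[C]_p) : rdot a (b + c) = rdot a b + rdot a c.
Proof.
by rewrite -big_split; apply: eq_bigr => k _; rewrite mxE re_add im_add /=; ring.
Qed.

Lemma rdotNr p (a b : 'cV[C]_p) : rdot a (- b) = - rdot a b.
Proof.
by rewrite -sumrN; apply: eq_bigr => k _; rewrite mxE re_opp im_opp; ring.
Qed.

Lemma rdotZr p r (a b : 'cV[C]_p) : rdot a (r%:C *: b) = r * rdot a b.
Proof.
by rewrite mulr_sumr; apply: eq_bigr => k _; rewrite mxE re_mul im_mul /=; ring.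
Qed.

Lemma rdotDl p (a b c : 'cV[C]_p) : rdot (a + b) c = rdot a c + rdot b c.
Proof. by rewrite rdotC rdotDr !(rdotC c). Qed.

Lemma rdotNl p (a b : 'cV[C]_p) : rdot (- a) b = - rdot a b.
Proof. by rewrite rdotC rdotNr rdotC. Qed.

Lemma rdotZl p r (a b : 'cV[C]_p) : rdot (r%:C *: a) b = r * rdot a b.
Proof. by rewrite rdotC rdotZr rdotC. Qed.

Lemma rdot0r p (a : 'cV[C]_p) : rdot a 0 = 0.
Proof. by rewrite -(subrr a) rdotDr rdotNr subrr. Qed.

Lemma rdot0l p (a : 'cV[C]_p) : rdot 0 a = 0.
Proof. by rewrite rdotC rdot0r. Qed.

Lemma rdotE p (a : 'cV[C]_p) : rdot a a = \sum_k Normc.normc (a k 0) ^+ 2.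
Proof. by apply: eq_bigr => k _; rewrite normc_sqr; ring. Qed.

Lemma rdot_ge0 p (a : 'cV[C]_p) : 0 <= rdot a a.
Proof. by rewrite rdotE sumr_ge0// => k _; rewrite sqr_ge0. Qed.
Hint Resolve rdot_ge0 : core.

Lemma rdot_eq0 p (a : 'cV[C]_p) : rdot a a = 0 -> a = 0.
Proof.
rewrite rdotE => /eqP; rewrite psumr_eq0; last by move=> k _; rewrite sqr_ge0.
move=> /allP h; apply/colP => k; rewrite mxE; apply/Normc.eq0_normc/eqP.
by have := h k (mem_index_enum k); rewrite /= sqrf_eq0.
Qed.

Lemma l2norm_rdot p (a : 'cV[C]_p) : l2norm a = Num.sqrt (rdot a a).
Proof. by rewrite /l2norm rdotE. Qed.

Lemma sqr_l2norm p (a : 'cV[C]_p) : l2norm a ^+ 2 = rdot a a.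
Proof. by rewrite l2norm_rdot sqr_sqrtr. Qed.

Lemma l2norm_ge0 p (a : 'cV[C]_p) : 0 <= l2norm a.
Proof. by rewrite l2norm_rdot sqrtr_ge0. Qed.

Lemma l2norm0 p : l2norm (0 : 'cV[C]_p) = 0.
Proof. by rewrite l2norm_rdot rdot0r sqrtr0. Qed.

Lemma l2norm_eq0 p (a : 'cV[C]_p) : l2norm a = 0 -> a = 0.
Proof. by move=> a0; apply: rdot_eq0; rewrite -sqr_l2norm a0 expr0n. Qed.

Lemma rdot_cauchy_schwarz p (a b : 'cV[C]_p) :
  rdot a b ^+ 2 <= rdot a a * rdot b b.
Proof.
have [b0|bN0] := eqVneq (rdot b b) 0.
  by rewrite (rdot_eq0 b0) rdot0r expr0n/= mulr_ge0.
have bp : 0 < rdot b b by rewrite lt_neqAle eq_sym bN0 rdot_ge0.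
rewrite -subr_ge0 -(pmulr_rge0 _ bp).
have := rdot_ge0 ((rdot b b)%:C *: a - (rdot a b)%:C *: b).
rewrite rdotDr rdotNr !rdotDl !rdotNl !rdotZr !rdotZl (rdotC b a).
by congr (0 <= _); ring.
Qed.

Lemma rdot_le p (a b : 'cV[C]_p) : `|rdot a b| <= l2norm a * l2norm b.
Proof.
rewrite -(@ler_pXn2r _ 2)// ?nnegrE ?mulr_ge0 ?l2norm_ge0//.
by rewrite exprMn !sqr_l2norm real_normK ?num_real// rdot_cauchy_schwarz.
Qed.

Lemma l2norm_triangle p (a b : 'cV[C]_p) :
  l2norm (a + b) <= l2norm a + l2norm b.
Proof.
rewrite -(@ler_pXn2r _ 2)// ?nnegrE ?addr_ge0 ?l2norm_ge0//.
rewrite sqr_l2norm rdotDr !rdotDl sqrrD !sqr_l2norm (rdotC b a).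
have := le_trans (ler_norm _) (rdot_le a b); lra.
Qed.

Lemma l2normZ p (t : C) (a : 'cV[C]_p) :
  l2norm (t *: a) = Normc.normc t * l2norm a.
Proof.
apply/eqP; rewrite -(@eqrXn2 _ 2)// ?mulr_ge0 ?l2norm_ge0 ?normc_ge0//.
rewrite exprMn !sqr_l2norm !rdotE mulr_sumr; apply/eqP/eq_bigr => k _.
by rewrite mxE Normc.normcM exprMn.
Qed.

Lemma l2norm_sum p (I : finType) (F : I -> 'cV[C]_p) :
  l2norm (\sum_i F i) <= \sum_i l2norm (F i).
Proof.
elim/big_ind2 : _ => [|a r b t ar bt|//]; first by rewrite l2norm0.
exact: le_trans (l2norm_triangle _ _) (lerD ar bt).
Qed.

Lemma sum_cauchy_schwarz (p : nat) (f g : 'I_p -> R) :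
  (\sum_k f k * g k) ^+ 2 <= (\sum_k f k ^+ 2) * (\sum_k g k ^+ 2).
Proof.
have := rdot_cauchy_schwarz (\col_k (f k)%:C) (\col_k (g k)%:C).
have E (u v : 'I_p -> R) :
    rdot (\col_k (u k)%:C) (\col_k (v k)%:C) = \sum_k u k * v k.
  by apply: eq_bigr => k _; rewrite !mxE /= mulr0 addr0.
by rewrite !E.
Qed.

Lemma l2norm_le_l1norm p (a : 'cV[C]_p) : l2norm a <= l1norm a.
Proof.
have -> : a = \sum_k a k 0 *: delta_mx k 0.
  apply/colP => k; rewrite summxE (bigD1 k)//= !mxE !eqxx mulr1 big1 ?addr0//.
  by move=> j jk; rewrite !mxE eq_sym (negbTE jk) mulr0.
apply: le_trans (l2norm_sum _) _; rewrite le_eqVlt; apply/orP; left.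
apply/eqP; apply: eq_bigr => k _.
rewrite l2normZ summxE (bigD1 k)//= !mxE !eqxx mulr1 big1 ?addr0; last first.
  by move=> j jk; rewrite !mxE eq_sym (negbTE jk) mulr0.
rewrite [X in _ * X](_ : _ = 1) ?mulr1//; apply/eqP.
rewrite -(@eqrXn2 _ 2)// ?l2norm_ge0// sqr_l2norm rdotE expr1n (bigD1 k)//=.
rewrite mxE !eqxx Normc.normc1 big1 ?addr0 ?expr1n// => j jk.
by rewrite mxE (negbTE jk) Normc.normc0 expr0n.
Qed.

Definition frob p q (A : 'M[C]_(p, q)) : R :=
  \sum_j rdot (col j A) (col j A).

Lemma frob_ge0 p q (A : 'M[C]_(p, q)) : 0 <= frob A.
Proof. by apply: sumr_ge0. Qed.

Lemma mulmx_col_sum p q (A : 'M[C]_(p, q)) (a : 'cV[C]_q) :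
  A *m a = \sum_j a j 0 *: col j A.
Proof.
apply/colP => k; rewrite mxE summxE; apply: eq_bigr => j _.
by rewrite !mxE mulrC.
Qed.

Lemma l2norm_mulmx p q (A : 'M[C]_(p, q)) (a : 'cV[C]_q) :
  l2norm (A *m a) <= Num.sqrt (frob A) * l2norm a.
Proof.
rewrite mulmx_col_sum; apply: le_trans (l2norm_sum _) _.
rewrite -(@ler_pXn2r _ 2)// ?nnegrE ?mulr_ge0 ?l2norm_ge0 ?sqrtr_ge0//; last first.
  by apply: sumr_ge0 => j _; exact: l2norm_ge0.
rewrite exprMn sqr_sqrtr ?frob_ge0// sqr_l2norm rdotE mulrC.
under eq_bigr do rewrite l2normZ.
under [X in _ <= _ * X]eq_bigr do rewrite -sqr_l2norm.
exact: sum_cauchy_schwarz.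
Qed.

Lemma rdot_adjoint p q (A : 'M[C]_(p, q)) (a : 'cV[C]_q) (b : 'cV[C]_p) :
  rdot a (A ^t* *m b) = rdot (A *m a) b.
Proof.
have E k (u v : 'cV[C]_k) : rdot u v = complex.Re ((u ^t* *m v) 0 0).
  rewrite mxE re_sum; apply: eq_bigr => j _.
  by rewrite !mxE re_mul re_conj im_conj; ring.
by rewrite !E trmx_mul map_mxM mulmxA.
Qed.

Lemma opnormP p q (A : 'M[C]_(p, q)) (a : 'cV[C]_q) :
  l2norm (A *m a) <= opnorm A * l2norm a.
Proof.
have [a0|aN0] := eqVneq (l2norm a) 0.
  by rewrite a0 mulr0 (l2norm_eq0 a0) mulmx0 l2norm0.
have ap : 0 < l2norm a by rewrite lt_neqAle eq_sym aN0 l2norm_ge0.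
have E : a = (l2norm a)%:C *: ((l2norm a)^-1%:C *: a).
  by rewrite scalerA -rmorphM divff// scale1r.
have nC (r : R) : 0 <= r -> Normc.normc r%:C = r.
  by move=> r0; rewrite /= expr0n addr0 sqrtr_sqr ger0_norm.
rewrite {1}E -scalemxAr l2normZ nC ?(ltW ap)// mulrC ler_wpM2r ?(ltW ap)//.
(* The set under the [sup] must be bounded above for [sup] to be meaningful; the Frobenius norm
   bounds it. *)
apply: ub_le_sup.
  exists (Num.sqrt (frob A)) => _ [z /= z1 <-].
  apply: le_trans (l2norm_mulmx _ _) _.
  by rewrite ler_piMr// sqrtr_ge0.
exists ((l2norm a)^-1%:C *: a) => //=.
by rewrite l2normZ nC ?invr_ge0 ?(ltW ap)// mulVf.
Qed.

End real_inner_product.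
#[global] Hint Extern 0 (is_true (0 <= rdot _ _)) => apply: rdot_ge0 : core.

(** * Dual certificates *)

Section coordinate_projection.
Context {R : realType} {n : nat}.
Variable S : {set 'I_n}.
Local Notation C := R[i].

(** Projecting inside [C^n] keeps every vector and matrix of the recursion in dimension [n], instead
    of restricting to columns indexed by ['I_#|S|]. *)
Definition prj : 'M[C]_n := \matrix_(i, j) ((i == j) && (i \in S))%:R.

Lemma prjE q (A : 'M[C]_(n, q)) i j :
  (prj *m A) i j = if i \in S then A i j else 0.
Proof.
rewrite mxE (bigD1 i)//= big1 ?addr0.
  by rewrite mxE eqxx; case: ifP => _; rewrite ?mul1r ?mul0r.
by move=> k ki; rewrite mxE eq_sym (negbTE ki) mul0r.
Qed.

Lemma prjK : prj *m prj = prj.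
Proof.
apply/matrixP => i j; rewrite prjE mxE.
by case: ifP => iS; rewrite ?iS// andbF.
Qed.

Lemma rdot_prj (a b : 'cV[C]_n) : rdot (prj *m a) b = rdot a (prj *m b).
Proof.
apply: eq_bigr => i _; rewrite !prjE.
by case: ifP => _ //=; rewrite !mul0r !mulr0.
Qed.

Lemma rdot_prj_prj (a b : 'cV[C]_n) :
  rdot (prj *m a) (prj *m b) = rdot (prj *m a) b.
Proof. by rewrite rdot_prj mulmxA prjK rdot_prj. Qed.

Lemma frob_prj : frob prj = #|S|%:R.
Proof.
rewrite /frob -sum1_card natr_sum [RHS]big_mkcond/=; apply: eq_bigr => j _.
rewrite rdotE (bigD1 j)//= !mxE eqxx/= big1 ?addr0; last first.
  by move=> k kj; rewrite !mxE (negbTE kj) Normc.normc0 expr0n.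
by case: ifP => _; rewrite ?Normc.normc1 ?Normc.normc0 ?expr1n ?expr0n.
Qed.

End coordinate_projection.
Arguments prj {R n} S.

Section dual_certificate.
Context {R : realType} {n : nat}.
Local Notation C := R[i].

(** Entries of [x] equal to [0] have sign [0], because [0 / 0 = 0]. *)
Definition sgnv (x : 'cV[C]_n) : 'cV[C]_n :=
  \col_i (x i 0 / (Normc.normc (x i 0))%:C).

Definition l1off (S : {set 'I_n}) (h : 'cV[C]_n) : R :=
  \sum_(i in ~: S) Normc.normc (h i 0).

Lemma l1off_ge0 S h : 0 <= l1off S h.
Proof. by apply: sumr_ge0 => i _; exact: normc_ge0. Qed.

Lemma l1off_eq0 S h : l1off S h = 0 -> prj S *m h = h.
Proof.
move=> /eqP; rewrite psumr_eq0; last by move=> i _; exact: normc_ge0.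
move=> /allP h0; apply/colP => i; rewrite prjE; case: ifPn => // iS.
have := h0 i (mem_index_enum i); rewrite inE iS /=.
by move=> /eqP /Normc.eq0_normc ->.
Qed.

Lemma l2norm_off_le S h : l2norm (h - prj S *m h) <= l1off S h.
Proof.
apply: le_trans (l2norm_le_l1norm _) _.
rewrite /l1norm /l1off [leRHS]big_mkcond/=; apply: ler_sum => i _.
rewrite mxE [X in _ + X]mxE prjE inE.
by case: ifP => _; rewrite ?subrr ?subr0 ?Normc.normc0.
Qed.

Lemma re_mul_le_normc (a b : C) :
  complex.Re a * complex.Re b + complex.Im a * complex.Im b <=
  Normc.normc a * Normc.normc b.
Proof.
apply: le_trans (ler_norm _) _.
rewrite -(@ler_pXn2r _ 2)// ?nnegrE ?mulr_ge0 ?normc_ge0//.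
rewrite exprMn !normc_sqr real_normK ?num_real//.
set p := complex.Re a; set q := complex.Re b.
set u := complex.Im a; set v := complex.Im b.
by have := sqr_ge0 (p * v - u * q); lra.
Qed.

Lemma normc_sgn_le1 (a : C) : Normc.normc (a / (Normc.normc a)%:C) <= 1.
Proof.
have [->|a0] := eqVneq a 0; first by rewrite mul0r Normc.normc0.
have na0 : Normc.normc a != 0 by apply: contra a0 => /eqP/Normc.eq0_normc ->.
have E : Normc.normc (Normc.normc a)%:C = Normc.normc a.
  by rewrite /= expr0n addr0 sqrtr_sqr ger0_norm ?normc_ge0.
by rewrite Normc.normcM Normc.normcV E divff.
Qed.

Lemma sgnv_le S x : supported_on S x -> rdot (sgnv x) (sgnv x) <= #|S|%:R.
Proof.
move=> xS; rewrite rdotE -sum1_card natr_sum [leRHS]big_mkcond/=.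
apply: ler_sum => i _; rewrite mxE; case: ifPn => iS.
  by rewrite exprn_ile1// ?normc_ge0// normc_sgn_le1.
by rewrite (xS _ iS) mul0r Normc.normc0 expr0n.
Qed.

Lemma prj_sgnv S x : supported_on S x -> prj S *m sgnv x = sgnv x.
Proof.
move=> xS; apply/colP => i; rewrite prjE mxE.
by case: ifPn => // /xS ->; rewrite mul0r.
Qed.

(** [z] is a subgradient of the modulus at [a]: its real product with [a] is the modulus of [a], and
    its own modulus is at most 1. *)
Lemma normc_subgradient (a b z : C) : z = a / (Normc.normc a)%:C ->
  Normc.normc a +
    (complex.Re z * complex.Re b + complex.Im z * complex.Im b) <=
  Normc.normc (a + b).
Proof.
move=> zE; have [a0|a0] := eqVneq a 0.
  by rewrite zE a0 mul0r !mul0r Normc.normc0 !add0r normc_ge0.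
have na0 : Normc.normc a != 0 by apply: contra a0 => /eqP/Normc.eq0_normc ->.
have -> : Normc.normc a = complex.Re z * complex.Re a + complex.Im z * complex.Im a.
  rewrite zE re_mul im_mul -fmorphV /= !mulr0 subr0 add0r.
  apply: (mulfI na0); rewrite -expr2 normc_sqr; field.
  exact: na0.
have := re_mul_le_normc z (a + b); rewrite re_add im_add => zab.
have := normc_sgn_le1 a; rewrite -zE => z1.
have := ler_wpM2r (normc_ge0 (a + b)) z1; lra.
Qed.

(** The subgradient inequality on [S] leaves the whole of [l1off S h] as a gain outside [S]. Since
    [u] is orthogonal to [h], replacing the sign vector by [u] costs at most 1/8 of it on [S] and
    3/4 outside, so that 1/8 remains. *)
Lemma l1norm_dual_certificate S (x u h : 'cV[C]_n) :
  supported_on S x -> rdot u h = 0 ->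
  (forall i, i \notin S -> Normc.normc (u i 0) <= 3 / 4) ->
  `|rdot (prj S *m (sgnv x - u)) h| <= 8^-1 * l1off S h ->
  l1norm x + 8^-1 * l1off S h <= l1norm (x + h).
Proof.
move=> xS uh uoff vh.
have step i : Normc.normc (x i 0) +
    (complex.Re (sgnv x i 0) * complex.Re (h i 0) +
     complex.Im (sgnv x i 0) * complex.Im (h i 0)) +
    (if i \in ~: S then Normc.normc (h i 0) else 0) <=
    Normc.normc ((x + h) i 0).
  rewrite [in leRHS]mxE inE; case: ifPn => iS /=.
    by rewrite mxE (xS _ iS) !mul0r Normc.normc0 !add0r.
  by rewrite addr0; apply: normc_subgradient; rewrite mxE.
have : l1norm x + rdot (sgnv x) h + l1off S h <= l1norm (x + h).
  rewrite /l1norm /rdot /l1off [X in _ + X <= _]big_mkcond/= -!big_split/=.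
  by apply: ler_sum => i _; exact: step.
have uhE : rdot (prj S *m u) h + rdot (u - prj S *m u) h = 0.
  by rewrite -rdotDl addrC subrK.
have : `|rdot (u - prj S *m u) h| <= 3 / 4 * l1off S h.
  rewrite /rdot /l1off mulr_sumr [leRHS]big_mkcond/=.
  apply: le_trans (ler_norm_sum _ _ _) _; apply: ler_sum => i _.
  rewrite mxE [X in u i 0 + X]mxE prjE inE; case: ifPn => iS /=.
    by rewrite subrr !mul0r addr0 normr0.
  rewrite subr0; apply: le_trans (ler_wpM2r (normc_ge0 _) (uoff _ iS)).
  rewrite ler_norml re_mul_le_normc andbT lerNl.
  have := re_mul_le_normc (- u i 0) (h i 0).
  have -> : Normc.normc (- u i 0) = Normc.normc (u i 0).
    by case: (u i 0) => a b /=; rewrite !sqrrN.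
  by rewrite re_opp im_opp; lra.
rewrite ler_norml => /andP[_ hi].
move: vh; rewrite ler_norml mulmxDr mulmxN (prj_sgnv xS) rdotDl rdotNl.
by move=> /andP[vlo _]; lra.
Qed.

End dual_certificate.

(** * The golfing recursion *)

Section golfing.
Context {R : realType} {n : nat}.
Local Notation C := R[i].
Variables (S : {set 'I_n}) (z : 'cV[C]_n) (g K : R).

Definition gram p (B : 'M[C]_(p, n)) : 'M[C]_n := B ^t* *m B.

Definition retr (G : 'M[C]_n) : R := \sum_j complex.Re (G j j).

Lemma rdot_gram p (B : 'M[C]_(p, n)) a b :
  rdot a (gram B *m b) = rdot (B *m a) (B *m b).
Proof. by rewrite -mulmxA rdot_adjoint. Qed.

Lemma retr_gram p (B : 'M[C]_(p, n)) : retr (gram B) = frob B.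
Proof.
apply: eq_bigr => j _; rewrite mxE re_sum; apply: eq_bigr => k _.
by rewrite !mxE re_mul re_conj im_conj; ring.
Qed.

(** Triple [(u, Q, M)]: the current certificate [u], the product [Q] of the
    contractions [Id - eta B_S^* B_S] so far, and a bound [M] on the error made
    when [Q] is used to invert [A_S]. *)
Definition gstate : Type := ('cV[C]_n * 'M[C]_n * R)%type.

Definition resid (u : 'cV[C]_n) : 'cV[C]_n := prj S *m (z - u).

Definition ynorm (u : 'cV[C]_n) : R := l2norm (resid u) / Num.sqrt #|S|%:R.

(** The step grows as the residual shrinks, so that the increments of [u] stay of
    order [1 / K] while the residual still vanishes after [O(g K)] blocks. *)
Definition eta (u : 'cV[C]_n) : R := (g * (2 + K * ynorm u))^-1.

(** The drift estimates range over all states, reachable or not, so [Q] is projected explicitly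
    instead of being assumed supported on the rows in [S]. *)
Definition qstep (e : R) (Q G : 'M[C]_n) : 'M[C]_n :=
  prj S *m Q - e%:C *: (prj S *m G *m (prj S *m Q)).

(** One step size drives both [u] and [Q], which keeps the residual equal to [Q z]. The increment of
    the third component is the Cauchy-Schwarz bound met in [gtraj_inverse]; the trace of [G] appears
    because isotropy alone gives its mean. *)
Definition gstep (st : gstate) (G : 'M[C]_n) : gstate :=
  (st.1.1 + (eta st.1.1)%:C *: (G *m resid st.1.1),
   qstep (eta st.1.1) st.1.2 G,
   st.2 + eta st.1.1 * Num.sqrt (frob (prj S *m st.1.2)) * retr G).

Definition gstart : gstate := (0, prj S, 0).

Fixpoint gtraj (G : nat -> 'M[C]_n) (k : nat) : gstate :=
  if k is k'.+1 then gstep (gtraj G k') (G k') else gstart.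

Lemma eta_ge0 u : 0 <= g -> 0 <= K -> 0 <= eta u.
Proof.
move=> g0 K0; rewrite /eta /ynorm invr_ge0 mulr_ge0 ?addr_ge0//.
by rewrite mulr_ge0 ?divr_ge0 ?l2norm_ge0 ?sqrtr_ge0.
Qed.

Lemma prj_qstep e Q G : prj S *m qstep e Q G = qstep e Q G.
Proof. by rewrite /qstep mulmxDr mulmxN -scalemxAr !mulmxA !prjK. Qed.

Section trajectory.
Variables (p : nat -> nat) (B : forall k, 'M[C]_(p k, n)) (N : nat).
Hypothesis g0 : 0 <= g.
Hypothesis K0 : 0 <= K.
Let st k := gtraj (fun k => gram (B k)) k.

Lemma prj_gtraj k : prj S *m (st k).1.2 = (st k).1.2.
Proof. by case: k => [|k]; rewrite /= ?prjK// prj_qstep. Qed.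

Lemma resid_gtraj k : resid (st k).1.1 = (st k).1.2 *m z.
Proof.
elim: k => [|k IH]; first by rewrite /resid/= subr0.
rewrite /resid /= opprD addrA mulmxDr -/(resid _) IH.
rewrite /qstep prj_gtraj mulmxDl mulmxN -scalemxAr mulNmx -scalemxAl.
by rewrite !mulmxA.
Qed.

Lemma gtraj_ge0 k : 0 <= (st k).2.
Proof.
elim: k => [//|k IH] /=; rewrite addr_ge0// mulr_ge0//.
  by rewrite mulr_ge0 ?eta_ge0 ?sqrtr_ge0.
by rewrite retr_gram frob_ge0.
Qed.

Variable h : 'cV[C]_n.
Hypothesis Bh : forall k, (k < N)%N -> B k *m h = 0.

Lemma rdot_gtraj k : (k <= N)%N -> rdot (st k).1.1 h = 0.
Proof.
elim: k => [|k IH] kN /=; first by rewrite rdot0l.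
by rewrite rdotDl IH 1?ltnW// rdotZl rdotC rdot_gram Bh// rdot0l mulr0 addr0.
Qed.

Let hS := prj S *m h.
Let hoff := h - prj S *m h.

(** [Id - Q] telescopes into terms [eta G Q_k]. In each of them [B hS = - B hoff], because [B] kills
    [h]; bounding [B (Q_k hS)] and [B hoff] by Frobenius norms produces exactly the increment of the
    third component. *)
Lemma gtraj_inverse k : (k <= N)%N ->
  rdot (hS - (st k).1.2 *m hS) hS <= (st k).2 * l2norm hoff * l2norm hS.
Proof.
elim: k => [|k IH] kN /=.
  by rewrite {1}/hS mulmxA prjK subrr rdot0l !mul0r.
have := IH (ltnW kN); rewrite -/(st k).
set Q := (st k).1.2; set e := eta _; set M := (st k).2 => IHk.
have QS : prj S *m Q = Q by exact: prj_gtraj.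
rewrite /qstep QS mulmxDl mulNmx -scalemxAl opprD opprK addrA rdotDl rdotZl.
rewrite -!mulmxA rdot_prj [prj S *m hS]mulmxA prjK -/hS.
rewrite [B k ^t* *m _]mulmxA -/(gram (B k)).
have -> : rdot (gram (B k) *m (Q *m hS)) hS =
    - rdot (B k *m (Q *m hS)) (B k *m hoff).
  rewrite rdotC rdot_gram rdotC -rdotNr; congr rdot.
  by rewrite /hoff mulmxDr mulmxN (Bh kN) sub0r opprK.
have e0 : 0 <= e by exact: eta_ge0.
have := rdot_le (B k *m (Q *m hS)) (B k *m hoff).
rewrite ler_norml => /andP[lo _].
have le1 := l2norm_mulmx (B k) (Q *m hS).
have le2 := l2norm_mulmx (B k) hoff.
have le3 := l2norm_mulmx Q hS.
have le4 := ler_pM (l2norm_ge0 _) (l2norm_ge0 _) le1 le2.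
have fB : Num.sqrt (frob (B k)) * Num.sqrt (frob (B k)) = frob (B k).
  by rewrite -expr2 sqr_sqrtr// frob_ge0.
have le5 : Num.sqrt (frob (B k)) * l2norm (Q *m hS) *
    (Num.sqrt (frob (B k)) * l2norm hoff) <=
    frob (B k) * l2norm hoff * (Num.sqrt (frob Q) * l2norm hS).
  rewrite -[in leRHS]fB.
  rewrite [leLHS](_ : _ = Num.sqrt (frob (B k)) * Num.sqrt (frob (B k)) *
    l2norm hoff * l2norm (Q *m hS)); last by ring.
  by rewrite ler_wpM2l// !mulr_ge0 ?sqrtr_ge0 ?l2norm_ge0.
have le6 : - rdot (B k *m (Q *m hS)) (B k *m hoff) <=
    frob (B k) * l2norm hoff * (Num.sqrt (frob Q) * l2norm hS) by lra.
have := ler_wpM2l e0 le6.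
rewrite retr_gram -/M; lra.
Qed.

(** The residual of the certificate is correlated with [h] only through [h_S],
    which [gtraj_inverse] controls by the part of [h] outside [S]. *)
Lemma gtraj_correlation :
  Num.sqrt (frob (st N).1.2) <= 2^-1 ->
  `|rdot (resid (st N).1.1) h| <=
  2 * (st N).2 * Num.sqrt (frob (st N).1.2) * l2norm z * l2norm hoff.
Proof.
set k := Num.sqrt _ => k2; have := gtraj_inverse (leqnn N).
rewrite rdotDl rdotNl -sqr_l2norm.
set M := (st N).2; set Q := (st N).1.2 in k k2 * => inv.
have QhS : rdot (Q *m hS) hS <= k * l2norm hS * l2norm hS.
  apply: le_trans (ler_norm _) _; apply: le_trans (rdot_le _ _) _.
  by rewrite ler_wpM2r ?l2norm_ge0// l2norm_mulmx.
have hSle : l2norm hS <= 2 * M * l2norm hoff.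
  have [->|hS0] := eqVneq (l2norm hS) 0.
    by rewrite !mulr_ge0 ?gtraj_ge0 ?l2norm_ge0.
  have hSp : 0 < l2norm hS by rewrite lt_neqAle eq_sym hS0 l2norm_ge0.
  rewrite -(ler_pM2r hSp).
  have := ler_wpM2r (mulr_ge0 (l2norm_ge0 hS) (l2norm_ge0 hS)) k2.
  by move: inv QhS; rewrite expr2; lra.
have QS : prj S *m Q = Q by exact: prj_gtraj.
rewrite resid_gtraj -/Q -{1}QS -mulmxA rdot_prj -/hS.
apply: le_trans (rdot_le _ _) _.
have h1 := l2norm_mulmx Q z.
have h2 := ler_pM (l2norm_ge0 _) (l2norm_ge0 _) h1 hSle.
by apply: le_trans h2 _; rewrite -/k; lra.
Qed.

End trajectory.
End golfing.

Lemma golfing_recovery (R : realType) (n N : nat) (S : {set 'I_n})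
    (x h : 'cV[R[i]]_n) (g K : R) (p : nat -> nat)
    (B : forall k, 'M[R[i]]_(p k, n)) :
  let st := gtraj S (sgnv x) g K (fun k => gram (B k)) N in
  0 <= g -> 0 <= K -> supported_on S x ->
  (forall i, i \notin S -> Normc.normc (st.1.1 i 0) <= 3 / 4) ->
  Num.sqrt (frob st.1.2) <= 2^-1 ->
  2 * st.2 * Num.sqrt (frob st.1.2) * Num.sqrt #|S|%:R <= 8^-1 ->
  (forall k, (k < N)%N -> B k *m h = 0) -> h != 0 ->
  l1norm x < l1norm (x + h).
Proof.
move=> st g0 K0 xS uoff q2 Mq Bh h0.
have k0 : 0 <= 2 * st.2 * Num.sqrt (frob st.1.2).
  by rewrite !mulr_ge0 ?sqrtr_ge0//; exact: gtraj_ge0.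
have corr := gtraj_correlation g0 K0 Bh q2.
have := @l1norm_dual_certificate _ _ S x st.1.1 h xS
  (rdot_gtraj S (sgnv x) g K Bh (leqnn N)) uoff.
have zle : l2norm (sgnv x) <= Num.sqrt #|S|%:R.
  by rewrite l2norm_rdot ler_wsqrtr// sgnv_le.
have le8 : 2 * st.2 * Num.sqrt (frob st.1.2) * l2norm (sgnv x) <= 8^-1.
  by apply: le_trans Mq; rewrite ler_wpM2l.
have : `|rdot (resid S (sgnv x) st.1.1) h| <= 8^-1 * l1off S h.
  apply: le_trans corr _; apply: ler_pM => //.
  - by rewrite mulr_ge0 ?l2norm_ge0.
  - exact: l2norm_ge0.
  - exact: l2norm_off_le.
move=> /[swap] /[apply] main; apply: lt_le_trans main.
rewrite ltrDl lt_neqAle mulr_ge0 ?l1off_ge0// andbT eq_sym mulf_neq0//.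
(* Without mass outside [S] the gain vanishes, but then [gtraj_inverse] with [hoff = 0] bounds
   [||h||^2] by [rdot (Q h) h], at most half of [||h||^2], which forces [h = 0]. *)
apply: contra h0 => /eqP /l1off_eq0 hS.
have := gtraj_inverse S (sgnv x) g0 K0 Bh (leqnn N).
rewrite hS subrr l2norm0 mulr0 mul0r rdotDl rdotNl -sqr_l2norm => inv.
have := le_trans (ler_norm _) (rdot_le (st.1.2 *m h) h).
have := ler_wpM2r (l2norm_ge0 h) (l2norm_mulmx st.1.2 h).
have := ler_wpM2r (mulr_ge0 (l2norm_ge0 h) (l2norm_ge0 h)) q2.
move: inv; rewrite -/st => inv a1 a2 a3.
have hh : l2norm h ^+ 2 <= 0 by rewrite expr2 in inv *; lra.
apply/eqP/l2norm_eq0/eqP; rewrite -sqrf_eq0 eq_le hh sqr_ge0//.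
Qed.

(** * One step of the recursion *)

Section exponential_bounds.
Context {R : realType}.

(** [1 - x <= expR (- x)] gives [expR x <= 1 / (1 - x) = 1 + x + x^2 / (1 - x)], and [1 / (1 - x)]
    is at most 3/2. No lower bound on [x] enters. *)
Lemma expR_le_quadratic (x : R) : x <= 3^-1 -> expR x <= 1 + x + 3 / 2 * x ^+ 2.
Proof.
move=> x3; have := expR_ge1Dx (- x); rewrite expRN => e1.
have ex := expR_gt0 x.
have : (1 - x) * expR x <= 1 by rewrite -ler_pdivlMr// mul1r.
have x2 := sqr_ge0 x; rewrite expr2 in x2 *.
have h : 1 <= (1 - x) * (1 + x + 3 / 2 * (x * x)).
  have : 0 <= (x * x) * (1 - 3 * x) by apply: mulr_ge0 => //; lra.
  lra.
move=> /le_trans /(_ h); rewrite ler_pM2l//; lra.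
Qed.

Lemma expRN_le_linear (t : R) : 0 <= t <= 1 -> expR (- t) <= 1 - t / 2.
Proof.
move=> /andP[t0 t1]; rewrite expRN.
have := expR_ge1Dx t => e1; have ex := expR_gt0 t.
rewrite -[leLHS]mul1r ler_pdivrMr//.
apply: le_trans (_ : (1 - t / 2) * (1 + t) <= _).
  have : 0 <= t * (1 - t) by rewrite mulr_ge0// subr_ge0.
  lra.
by rewrite ler_wpM2l//; lra.
Qed.

Lemma sqrB_le (a b : R) : (a - b) ^+ 2 <= 2 * a ^+ 2 + 2 * b ^+ 2.
Proof. by have := sqr_ge0 (a + b); rewrite !expr2; lra. Qed.

(** The concave square root lies below its tangent at [b]. For [b = 0] the convention on division
    makes the correction 0. *)
Lemma sqrt_le_tangent (a b e : R) : 0 <= a -> 0 <= e -> a <= b - e ->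
  Num.sqrt a <= Num.sqrt b - e / (2 * Num.sqrt b).
Proof.
move=> a0 e0 abe; have b0 : 0 <= b by lra.
have [b00|bN0] := eqVneq b 0.
  have -> : a = 0 by lra.
  rewrite b00; by rewrite !sqrtr0 mulr0 invr0 mulr0 subrr.
have sb : 0 < Num.sqrt b by rewrite sqrtr_gt0 lt_neqAle eq_sym bN0.
rewrite -(ler_pM2r sb) mulrBl.
have -> : e / (2 * Num.sqrt b) * Num.sqrt b = e / 2.
  by field; rewrite lt0r_neq0.
have := sqr_ge0 (Num.sqrt a - Num.sqrt b).
rewrite sqrrB !sqr_sqrtr// -[X in _ <= X - _]expr2 sqr_sqrtr//; lra.
Qed.

End exponential_bounds.

Section one_step.
Context {R : realType} {n : nat}.
Local Notation C := R[i].
Variables (S : {set 'I_n}) (z : 'cV[C]_n) (g K : R).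
Hypothesis g0 : 0 < g.
Hypothesis K0 : 0 < K.
Let s : R := Num.sqrt #|S|%:R.

Local Notation eta := (eta S z g K).
Local Notation ynorm := (ynorm S z).
Local Notation resid := (resid S z).

Definition contracting (G : 'M[C]_n) (a : 'cV[C]_n) : Prop :=
  [/\ 0 <= rdot a (G *m a), rdot a (G *m a) <= g * rdot a a &
      rdot (prj S *m (G *m a)) (prj S *m (G *m a)) <= g * rdot a (G *m a)].

Definition gcols (Q : 'M[C]_n) (j : 'I_n) : 'cV[C]_n := col j (prj S *m Q).

(** Real trace of [Q^* P G P Q] with [P = prj S]: times [eta], the guaranteed decrease of the
    squared Frobenius norm. Under isotropy its mean is [frob (prj S *m Q)]. *)
Definition qdrop (Q G : 'M[C]_n) : R :=
  \sum_j rdot (gcols Q j) (G *m gcols Q j).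

Lemma prj_gcols Q j : prj S *m gcols Q j = gcols Q j.
Proof. by rewrite /gcols !colE !mulmxA prjK. Qed.

Lemma prj_resid u : prj S *m resid u = resid u.
Proof. by rewrite /resid mulmxA prjK. Qed.

Lemma ynorm_ge0 u : 0 <= ynorm u.
Proof. by rewrite divr_ge0 ?l2norm_ge0 ?sqrtr_ge0. Qed.

Lemma eta_gt0 u : 0 < eta u.
Proof.
rewrite invr_gt0 mulr_gt0// ltr_pwDl// mulr_ge0 ?ynorm_ge0//.
exact: ltW.
Qed.

Lemma etaE u : eta u * g * (2 + K * ynorm u) = 1.
Proof.
rewrite -mulrA mulVf// mulf_neq0 ?lt0r_neq0// ltr_pwDl// mulr_ge0 ?ynorm_ge0//.
exact: ltW.
Qed.

Lemma eta_g_le u : eta u * g <= 1.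
Proof.
have := etaE u; have : 0 <= eta u * g * (K * ynorm u).
  apply: mulr_ge0; apply: mulr_ge0.
  - exact: ltW (eta_gt0 u).
  - exact: ltW.
  - exact: ltW.
  - exact: ynorm_ge0.
have : 0 < eta u * g by rewrite mulr_gt0 ?eta_gt0.
lra.
Qed.

Lemma eta_y_le u : K * (eta u * g * ynorm u) <= 1.
Proof.
have := etaE u; have : 0 < eta u * g by rewrite mulr_gt0 ?eta_gt0.
lra.
Qed.

(** Expanding the square gives a first-order term [- 2 e rdot a (G a)]; the last clause of
    [contracting] and [e g <= 1] let the second-order term consume at most half of it. *)
Lemma contraction_step G a e : prj S *m a = a -> contracting G a ->
  0 <= e -> e * g <= 1 ->
  let a' := a - e%:C *: (prj S *m (G *m a)) in
  rdot a' a' <= rdot a a - e * rdot a (G *m a).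
Proof.
move=> aS [q0 _ q2] e0 eg /=.
rewrite rdotDr rdotNr !rdotDl !rdotNl !rdotZr !rdotZl.
rewrite [rdot (prj S *m (G *m a)) a]rdotC -[rdot a (prj S *m _)]rdot_prj aS.
set q := rdot a (G *m a) in q0 q2 *.
set w := rdot (prj S *m _) _ in q2 *.
have : e * (e * w) <= e * (e * (g * q)) by rewrite !ler_wpM2l.
have : e * q * (e * g) <= e * q * 1 by rewrite ler_wpM2l// mulr_ge0.
lra.
Qed.

Lemma resid_step u G e :
  resid (u + e%:C *: (G *m resid u)) =
  resid u - e%:C *: (prj S *m (G *m resid u)).
Proof.
by rewrite {1}/resid opprD addrA mulmxDr -/(resid u) mulmxN -scalemxAr.
Qed.

Lemma ynorm_step u G : contracting G (resid u) ->
  ynorm (u + (eta u)%:C *: (G *m resid u)) <=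
  ynorm u - eta u * rdot (resid u) (G *m resid u) / (2 * l2norm (resid u) * s).
Proof.
move=> cG; rewrite /ynorm resid_step.
have e0 := ltW (eta_gt0 u).
have := contraction_step (prj_resid u) cG e0 (eta_g_le u).
case: cG => q0 _ _ /= /sqrt_le_tangent.
move=> /(_ (rdot_ge0 _) (mulr_ge0 e0 q0)); rewrite -!l2norm_rdot => le1.
have s0 : 0 <= s^-1 by rewrite invr_ge0 sqrtr_ge0.
have := ler_wpM2r s0 le1; rewrite mulrBl -!mulrA.
by rewrite !invfM; congr (_ <= _ - _); rewrite -!mulrA.
Qed.

Definition ydrop (u : 'cV[C]_n) (G : 'M[C]_n) : R :=
  eta u * rdot (resid u) (G *m resid u) / (2 * l2norm (resid u) * s).

(** The term [K * ynorm u] in [eta] makes this second bound possible; it keeps the [ynorm] exponents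
    of [potQ] and [potU] in a range where the exponential is nearly linear. *)
Lemma ydrop_bounds u G : contracting G (resid u) ->
  0 <= ydrop u G /\ K * ydrop u G <= 2^-1.
Proof.
case=> q0 q1 _; split.
  by rewrite divr_ge0 ?mulr_ge0 ?sqrtr_ge0 ?l2norm_ge0 ?(ltW (eta_gt0 u)).
apply: le_trans (_ : 2^-1 * (K * (eta u * g * ynorm u)) <= _); last first.
  by have := eta_y_le u; lra.
rewrite [leRHS]mulrCA ler_wpM2l ?(ltW K0)// /ydrop /ynorm -/s.
have [->|l0] := eqVneq (l2norm (resid u)) 0.
  by rewrite mulr0 !mul0r invr0 !mulr0.
have -> : 2^-1 * (eta u * g * (l2norm (resid u) / s)) =
  eta u * (g * l2norm (resid u) ^+ 2) / (2 * l2norm (resid u) * s).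
  have [->|sN0] := eqVneq s 0; first by rewrite invr0 !mulr0 invr0 mulr0.
  by field; rewrite l0 sN0.
rewrite ler_wpM2r ?invr_ge0 ?mulr_ge0 ?sqrtr_ge0 ?l2norm_ge0//.
by rewrite sqr_l2norm ler_wpM2l// ltW ?eta_gt0.
Qed.

Lemma frob_step u Q G : (forall j, contracting G (gcols Q j)) ->
  frob (qstep S (eta u) Q G) <= frob (prj S *m Q) - eta u * qdrop Q G.
Proof.
move=> cG; rewrite /frob /qdrop mulr_sumr -sumrB; apply: ler_sum => j _.
have -> : col j (qstep S (eta u) Q G) =
    gcols Q j - (eta u)%:C *: (prj S *m (G *m gcols Q j)).
  by rewrite /qstep /gcols !colE mulmxDl mulNmx -scalemxAl !mulmxA.
apply: contraction_step => //; [exact: prj_gcols | exact: ltW (eta_gt0 u) |].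
exact: eta_g_le.
Qed.

Lemma qdrop_ge0 Q G : (forall j, contracting G (gcols Q j)) -> 0 <= qdrop Q G.
Proof. by move=> cG; apply: sumr_ge0 => j _; case: (cG j). Qed.

(** Each of the three potentials is a supermartingale along the recursion:
    [potC] bounds [M], [potQ] forces [Q] to decay, and [potU c] yields an
    exponential tail for [rdot c u]. In [potQ] and [potU] the factor depending on
    [ynorm] pays for the slow steps taken while the residual is large. *)
Definition potC (st : gstate) : R :=
  `|st.2| + 2 * n%:R * Num.sqrt (frob (prj S *m st.1.2)).

Definition potQ (st : gstate) : R :=
  frob (prj S *m st.1.2) * expR (2 * K * ynorm st.1.1).

Definition potU (c : 'cV[C]_n) (st : gstate) : R :=
  expR (K / 32 * rdot c st.1.1 + K / 128 * ynorm st.1.1).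

Lemma potC_step st G : (forall j, contracting G (gcols st.1.2 j)) ->
  0 <= retr G ->
  potC (gstep S z g K st G) <=
  potC st + eta st.1.1 * Num.sqrt (frob (prj S *m st.1.2)) * retr G -
  n%:R * eta st.1.1 / Num.sqrt (frob (prj S *m st.1.2)) * qdrop st.1.2 G.
Proof.
case: st => -[u Q] M /= cG tG; rewrite /potC /= prj_qstep.
set f := Num.sqrt (frob (prj S *m Q)).
have e0 := ltW (eta_gt0 u).
have le1 : `|M + eta u * f * retr G| <= `|M| + eta u * f * retr G.
  apply: le_trans (ler_normD _ _) _; rewrite lerD2l ger0_norm//.
  by rewrite !mulr_ge0 ?sqrtr_ge0.
have := sqrt_le_tangent (frob_ge0 _) (mulr_ge0 e0 (qdrop_ge0 cG)) (frob_step u cG).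
rewrite -/f => le2.
have := ler_wpM2l (mulr_ge0 (ler0n R 2) (ler0n R n)) le2.
rewrite invfM.
have -> : 2%:R * n%:R * (f - eta u * qdrop Q G * (2^-1 * f^-1)) =
  2 * n%:R * f - n%:R * eta u / f * qdrop Q G :> R.
  by move: f^-1 => w; field.
lra.
Qed.

Lemma potQ_step st G : (forall j, contracting G (gcols st.1.2 j)) ->
  contracting G (resid st.1.1) ->
  potQ (gstep S z g K st G) <=
  expR (2 * K * ynorm st.1.1) * (frob (prj S *m st.1.2) -
    eta st.1.1 / 2 * qdrop st.1.2 G -
    frob (prj S *m st.1.2) * K * ydrop st.1.1 G).
Proof.
case: st => -[u Q] M /= cQ cu; rewrite /potQ /= prj_qstep.
have le1 := frob_step u cQ; have D0 := qdrop_ge0 cQ.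
have [y0 y1] := ydrop_bounds cu.
have e0 := ltW (eta_gt0 u).
set F := frob (prj S *m Q) in le1 *; set F' := frob (qstep _ _ _ _) in le1 *.
set D := qdrop Q G in le1 D0 *; set y := ydrop u G in y0 y1 *.
have le2 : expR (2 * K * ynorm (u + (eta u)%:C *: (G *m resid u))) <=
    expR (2 * K * ynorm u) * (1 - K * y).
  apply: le_trans (_ : expR (2 * K * ynorm u - 2 * K * y) <= _).
    rewrite ler_expR -mulrBr ler_wpM2l ?mulr_ge0 ?(ltW K0)//.
    exact: ynorm_step.
  rewrite expRD ler_wpM2l ?expR_ge0//.
  have : 0 <= 2 * K * y <= 1.
    apply/andP; split; first by apply: mulr_ge0 => //; rewrite mulr_ge0 ?(ltW K0).
    lra.
  by move=> /expRN_le_linear; lra.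
have F'0 : 0 <= F' := frob_ge0 _.
apply: le_trans (ler_wpM2l F'0 le2) _.
rewrite mulrCA ler_wpM2l ?expR_ge0//.
move: (eta u) e0 le1 => e e0 le1; clear le2; clearbody F F' D y.
(* The cross term [e D K y] of this product is at most [e D / 2], since [K y <= 1/2]; hence the
   [eta / 2] in front of [qdrop]. *)
apply: le_trans (_ : (F - e * D) * (1 - K * y) <= _).
  by rewrite ler_wpM2r//; lra.
have := ler_wpM2l (mulr_ge0 e0 D0) y1; lra.
Qed.

Lemma potU_step c st G : contracting G (resid st.1.1) ->
  `|rdot c (G *m resid st.1.1)| <= g * ynorm st.1.1 ->
  potU c (gstep S z g K st G) <= potU c st * (1 +
    K / 32 * eta st.1.1 * rdot c (G *m resid st.1.1) -
    (K / 128 - K / 1024) * ydrop st.1.1 G +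
    3 * (K / 32 * eta st.1.1) ^+ 2 * rdot c (G *m resid st.1.1) ^+ 2).
Proof.
case: st => -[u Q] M /= cu cb; rewrite /potU /=.
have [y0 y1] := ydrop_bounds cu.
have e0 := ltW (eta_gt0 u).
have le1 := ynorm_step cu; rewrite -/(ydrop u G) in le1.
have ey := eta_y_le u.
rewrite rdotDr rdotZr.
move: (rdot c (G *m _)) cb (ydrop u G) y0 y1 le1 => r cb y y0 y1.
move: (ynorm u) (eta u) (rdot c u) (ynorm (u + _)) e0 ey cb => w e v w2 e0 ey cb le1.
have t0 : 0 <= K / 32 * e by rewrite !mulr_ge0 ?(ltW K0)// invr_ge0 ler0n.
(* [K e g w <= 1] bounds the increment of the exponent whatever the residual, so the quadratic bound
   applies to [t - l]. *)
have tle : K / 32 * e * r <= 32^-1.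
  have := ler_wpM2l t0 (le_trans (ler_norm _) cb); lra.
set t := K / 32 * e * r in tle *; set l := K / 128 * y.
have l0 : 0 <= l by rewrite !mulr_ge0 ?(ltW K0)// invr_ge0 ler0n.
apply: le_trans (_ : expR (K / 32 * v + K / 128 * w) * expR (t - l) <= _).
  rewrite -expRD ler_expR.
  have := ler_wpM2l (divr_ge0 (ltW K0) (ler0n R 128)) le1; rewrite /t /l; lra.
rewrite ler_wpM2l ?expR_ge0//.
apply: le_trans (expR_le_quadratic _) _; first by clearbody t l; lra.
have sq := sqrB_le t l.
have tt : t ^+ 2 = (K / 32 * e) ^+ 2 * r ^+ 2 by rewrite -exprMn.

have lE : l = K / 128 * y by [].
clearbody t l.
(* As [K y <= 1/2], the square of [l] is absorbed by a small part of the linear gain: the [K / 1024]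
   removed in the statement. *)
have ll : 2 * l ^+ 2 <= K / 2048 * y.
  have k0 : 0 <= K * y by rewrite mulr_ge0// ltW.
  have := ler_wpM2l k0 y1; rewrite lE expr2; lra.
move: sq ll; rewrite tt lE; lra.
Qed.

End one_step.

(** * Measurability *)

Section measurable_matrices.
Context {R : realType} {d : measure_display} {T : measurableType d}.
Local Notation C := R[i].

Definition cmeas (D : set T) (f : T -> C) : Prop :=
  measurable_fun D (fun t => complex.Re (f t)) /\
  measurable_fun D (fun t => complex.Im (f t)).

Definition mxmeas (D : set T) p q (X : T -> 'M[C]_(p, q)) : Prop :=
  forall i j, cmeas D (fun t => X t i j).

Lemma cmeas_sum D (I : Type) (s : seq I) (f : I -> T -> C) :
  (forall i, cmeas D (f i)) -> cmeas D (fun t => \sum_(i <- s) f i t).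
Proof.
move=> mf; split; [under eq_fun do rewrite re_sum|under eq_fun do rewrite im_sum];
  by apply: measurable_sum => i; case: (mf i).
Qed.

Lemma cmeasM D (f h : T -> C) :
  cmeas D f -> cmeas D h -> cmeas D (fun t => f t * h t).
Proof.
move=> [f1 f2] [h1 h2]; split.
  under eq_fun do rewrite re_mul.
  by apply: measurable_funB; apply: measurable_funM.
under eq_fun do rewrite im_mul.
by apply: measurable_funD; apply: measurable_funM.
Qed.

Lemma mxmeas_cst D p q (A : 'M[C]_(p, q)) : mxmeas D (fun _ => A).
Proof. by move=> i j; split; exact: measurable_cst. Qed.

Lemma mxmeasD D p q (X Y : T -> 'M[C]_(p, q)) :
  mxmeas D X -> mxmeas D Y -> mxmeas D (fun t => X t + Y t).
Proof.
move=> mX mY i j; have [x1 x2] := mX i j; have [y1 y2] := mY i j; split.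
  by under eq_fun do rewrite mxE re_add; exact: measurable_funD.
by under eq_fun do rewrite mxE im_add; exact: measurable_funD.
Qed.

Lemma mxmeasN D p q (X : T -> 'M[C]_(p, q)) :
  mxmeas D X -> mxmeas D (fun t => - X t).
Proof.
move=> mX i j; have [x1 x2] := mX i j; split.
  by under eq_fun do rewrite mxE re_opp; exact: measurable_funN.
by under eq_fun do rewrite mxE im_opp; exact: measurable_funN.
Qed.

Lemma mxmeasM D p q r (X : T -> 'M[C]_(p, q)) (Y : T -> 'M[C]_(q, r)) :
  mxmeas D X -> mxmeas D Y -> mxmeas D (fun t => X t *m Y t).
Proof.
move=> mX mY i j.
have -> : (fun t => (X t *m Y t) i j) = fun t => \sum_k X t i k * Y t k j.
  by apply/funext => t; rewrite mxE.
by apply: cmeas_sum => k; exact: cmeasM.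
Qed.

Lemma mxmeasZ D p q (f : T -> R) (X : T -> 'M[C]_(p, q)) :
  measurable_fun D f -> mxmeas D X -> mxmeas D (fun t => (f t)%:C *: X t).
Proof.
move=> mf mX i j.
have -> : (fun t => ((f t)%:C *: X t) i j) = fun t => (f t)%:C * X t i j.
  by apply/funext => t; rewrite mxE.
by apply: cmeasM => //; split => //=; exact: measurable_cst.
Qed.

Lemma mxmeas_adjoint D p q (X : T -> 'M[C]_(p, q)) :
  mxmeas D X -> mxmeas D (fun t => (X t) ^t*).
Proof.
move=> mX i j; have [x1 x2] := mX j i; split.
  by under eq_fun do rewrite !mxE re_conj.
by under eq_fun do rewrite !mxE im_conj; exact: measurable_funN.
Qed.

Lemma mxmeas_col D p q (X : T -> 'M[C]_(p, q)) j :
  mxmeas D X -> mxmeas D (fun t => col j (X t)).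
Proof.
move=> mX i k; have [x1 x2] := mX i j.
by split; under eq_fun do rewrite mxE.
Qed.

Lemma measurable_rdot D p (X Y : T -> 'cV[C]_p) : mxmeas D X -> mxmeas D Y ->
  measurable_fun D (fun t => rdot (X t) (Y t)).
Proof.
move=> mX mY; apply: measurable_sum => k.
have [x1 x2] := mX k 0; have [y1 y2] := mY k 0.
by apply: measurable_funD; apply: measurable_funM.
Qed.

Lemma measurable_frob D p q (X : T -> 'M[C]_(p, q)) : mxmeas D X ->
  measurable_fun D (fun t => frob (X t)).
Proof.
move=> mX; apply: measurable_sum => k.
by apply: measurable_rdot; exact: mxmeas_col.
Qed.

Lemma measurable_retr D n (X : T -> 'M[C]_n) : mxmeas D X ->
  measurable_fun D (fun t => retr (X t)).
Proof. by move=> mX; apply: measurable_sum => k; case: (mX k k). Qed.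

Lemma measurable_fun_sqrt D (f : T -> R) : measurable_fun D f ->
  measurable_fun D (fun t => Num.sqrt (f t)).
Proof.
move=> mf; apply: (measurableT_comp _ mf).
by apply: continuous_measurable_fun; exact: sqrt_continuous.
Qed.

Lemma measurable_l2norm D p (X : T -> 'cV[C]_p) : mxmeas D X ->
  measurable_fun D (fun t => l2norm (X t)).
Proof.
move=> mX; under eq_fun do rewrite l2norm_rdot.
by apply: measurable_fun_sqrt; exact: measurable_rdot.
Qed.

Lemma measurable_fun_inv D (f : T -> R) : (forall t, 0 < f t) ->
  measurable_fun D f -> measurable_fun D (fun t => (f t)^-1).
Proof.
move=> f0 mf.
have -> : (fun t => (f t)^-1) = fun t => expR (- ln (f t)).
  by apply/funext => t; rewrite expRN lnK// posrE.
apply: measurableT_comp => //; apply: measurable_funN.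
by apply: (measurableT_comp _ mf); exact: measurable_ln.
Qed.

End measurable_matrices.

Section measurable_gram.
Context {R : realType} {n : nat}.
Local Notation C := R[i].
Local Notation blk := (blockType R n).

Let of_height p : set blk := [set b | block_height b = p].
(** [conform_mx] avoids transport along an equality of heights; blocks of another height get the
    junk value 0. *)
Let block_as p (b : blk) : 'M[C]_(p, n) := conform_mx 0 (block_val b).

Let orthant p (a c : 'M[R]_(p, n)) : set blk :=
  [set b | of_height p b /\ forall k j,
     complex.Re (block_as p b k j) <= a k j /\
     complex.Im (block_as p b k j) <= c k j].

Let measurable_orthant p a c : measurable (@orthant p a c).
Proof.
apply: sub_sigma_algebra; exists p, a, c; apply/seteqP; split.
  move=> [p' M] [/= hp]; rewrite /of_height/= /block_height/= in hp.
  subst p'; rewrite /block_as conform_mx_id => Mac.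
  by exists M.
move=> _ [M /= Mac <-]; split => //.
by rewrite /block_as conform_mx_id.
Qed.

Let entry_bound p (M : 'M[C]_(p, n)) : exists N : nat, forall k j,
  complex.Re (M k j) <= N%:R /\ complex.Im (M k j) <= N%:R.
Proof.
pose s := \sum_k \sum_j (`|complex.Re (M k j)| + `|complex.Im (M k j)|).
exists (Num.truncn s).+1 => k j.
have s0 : 0 <= s by apply: sumr_ge0 => ? _; apply: sumr_ge0 => ? _; exact: addr_ge0.
have ls : s <= (Num.truncn s).+1%:R by rewrite ltW// truncnS_gt.
have : `|complex.Re (M k j)| + `|complex.Im (M k j)| <= s.
  rewrite /s (bigD1 k)//= (bigD1 j)//= -addrA lerDl addr_ge0//.
    by apply: sumr_ge0 => ? _; exact: addr_ge0.
  by apply: sumr_ge0 => ? _; apply: sumr_ge0 => ? _; exact: addr_ge0.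
have := ler_norm (complex.Re (M k j)); have := ler_norm (complex.Im (M k j)).
have := normr_ge0 (complex.Re (M k j)); have := normr_ge0 (complex.Im (M k j)).
by split; lra.
Qed.

Let measurable_of_height p : measurable (of_height p).
Proof.
rewrite [X in measurable X](_ : _ =
    \bigcup_(N : nat) orthant (const_mx N%:R) (const_mx N%:R : 'M[R]_(p, n))).
  by apply: bigcupT_measurable => N; exact: measurable_orthant.
apply/seteqP; split=> [b bp|b [N _ []]//].
have [N HN] := entry_bound (block_as p b).
by exists N => //; split => // k j; rewrite !mxE.
Qed.

Let mxmeas_block_as p : mxmeas (of_height p) (block_as p).
Proof.
move=> k j; split; move=> mD; apply: (measurability _ (RGenOInfty.measurableE R)) => //;
    move=> /= _ [_ [r ->] <-].
(* At height [p], the real part of entry [(k, j)] is at most [r] exactly when the block lies, for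
   some [N], in the orthant with bound [r] there and [N] for every other coordinate. *)
- rewrite [X in measurable X](_ : _ = of_height p `\` \bigcup_(N : nat)
    orthant (\matrix_(k', j') if (k', j') == (k, j) then r else N%:R)
      (const_mx N%:R : 'M[R]_(p, n))).
    apply: measurableD => //.
    by apply: bigcupT_measurable => N; exact: measurable_orthant.
  apply/seteqP; split=> b [bp]; rewrite /= ?in_itv/= ?andbT => br; split => //.
    move=> [N _ [_ /(_ k j)]]; rewrite !mxE eqxx => -[le _].
    by move: br; rewrite ltNge le.
  rewrite ltNge; apply/negP => le; apply: br.
  have [N HN] := entry_bound (block_as p b); exists N => //; split => // k' j'.
  by rewrite !mxE; case: eqP => [[-> ->]|_]; split => //; case: (HN k' j') => //;
    case: (HN k j).
- rewrite [X in measurable X](_ : _ = of_height p `\` \bigcup_(N : nat)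
    orthant (const_mx N%:R : 'M[R]_(p, n))
      (\matrix_(k', j') if (k', j') == (k, j) then r else N%:R)).
    apply: measurableD => //.
    by apply: bigcupT_measurable => N; exact: measurable_orthant.
  apply/seteqP; split=> b [bp]; rewrite /= ?in_itv/= ?andbT => br; split => //.
    move=> [N _ [_ /(_ k j)]]; rewrite !mxE eqxx => -[_ le].
    by move: br; rewrite ltNge le.
  rewrite ltNge; apply/negP => le; apply: br.
  have [N HN] := entry_bound (block_as p b); exists N => //; split => // k' j'.
  by rewrite !mxE; case: eqP => [[-> ->]|_]; split => //; case: (HN k' j') => //;
    case: (HN k j).
Qed.

Lemma mxmeas_gram : mxmeas setT (fun b : blk => gram (block_val b)).
Proof.
have cover : [set: blk] = \bigcup_p of_height p.
  by apply/seteqP; split => // b _; exists (block_height b).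
have E p : {in of_height p, forall b, gram (block_val b) =
    (block_as p b) ^t* *m block_as p b}.
  move=> b /set_mem bp; rewrite /of_height/= in bp.
  by rewrite /block_as; subst p; rewrite conform_mx_id.
move=> i j; rewrite cover; split; apply/measurable_fun_bigcup => // p.
  apply: (eq_measurable_fun (fun b =>
    complex.Re (((block_as p b) ^t* *m block_as p b) i j))).
    by move=> b bp; rewrite (E p).
  have [] // := mxmeasM (mxmeas_adjoint (@mxmeas_block_as p)) (@mxmeas_block_as p) i j.
apply: (eq_measurable_fun (fun b =>
  complex.Im (((block_as p b) ^t* *m block_as p b) i j))).
  by move=> b bp; rewrite (E p).
have [] // := mxmeasM (mxmeas_adjoint (@mxmeas_block_as p)) (@mxmeas_block_as p) i j.
Qed.

End measurable_gram.

(** * Chains driven by independent blocks *)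

Section markov_chain_of_iid.
Context {R : realType} {d dU dV : measure_display}.
Context {T : measurableType d} {U : measurableType dU} {V : measurableType dV}.
Variables (P : probability T R) (mu : probability U R).
Local Open Scope ereal_scope.

Lemma finite_prod_measure_ext (m1 m2 : {measure set (V * U) -> \bar R}) :
  m1 setT < +oo ->
  (forall A B, measurable A -> measurable B -> m1 (A `*` B) = m2 (A `*` B)) ->
  forall C, measurable C -> m1 C = m2 C.
Proof.
move=> m1oo m12 C mC.
apply: (measure_unique [set A `*` B | A in @measurable _ V & B in @measurable _ U]
  (fun=> setT)) => //.
- exact: measurable_prod_measurableType.
- move=> _ _ [A mA [B mB <-]] [A' mA' [B' mB' <-]].
  exists (A `&` A'); first exact: measurableI.
  by exists (B `&` B'); [exact: measurableI | rewrite setXI].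
- by move=> _; exists setT => //; exists setT => //; rewrite setXTT.
- by apply/seteqP; split => // x _; exists 0%N.
- by move=> _ [A mA [B mB <-]]; exact: m12.
Qed.

Variables (m : nat) (X : nat -> T -> U) (F : V * U -> V) (y0 : V).
Hypothesis mX : forall k, measurable_fun setT (X k).
Hypothesis mF : measurable_fun setT F.

Definition box (E : nat -> set U) : set T := \bigcap_(k < m) X k @^-1` E k.

Hypothesis indepX : forall E, (forall k, measurable (E k)) ->
  P (box E) = \prod_(k < m) mu (E k).

Fixpoint chain (k : nat) (w : T) : V :=
  if k is k'.+1 then F (chain k' w, X k' w) else y0.

Lemma measurable_chain k : measurable_fun setT (chain k).
Proof.
elim: k => [|k IH] /=; first exact: measurable_cst.
by apply: measurableT_comp => //; exact: measurable_fun_pair.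
Qed.

Let preU A (f : T -> U) : measurable A -> measurable_fun setT f ->
  measurable (f @^-1` A).
Proof. by move=> mA mf; rewrite -[X in measurable X]setTI; exact: mf. Qed.

Let measurable_box E : (forall k, measurable (E k)) -> measurable (box E).
Proof. by move=> mE; apply: bigcap_measurableType => k _; exact: preU. Qed.

Let step k w : V * U := (chain k w, X k w).

Let measurable_step k : measurable_fun setT (step k).
Proof. by apply: measurable_fun_pair => //; exact: measurable_chain. Qed.

(** Independence of the state at time [k] from the blocks still to come; the sets of index below [k]
    are full because the state has already used those blocks. *)
Let indep_at k := forall A E, measurable A -> (forall j, measurable (E j)) ->
  (forall j, (j < k)%N -> E j = setT) ->
  P (chain k @^-1` A `&` box E) =
  P (chain k @^-1` A) * \prod_(j < m) mu (E j).

Let probT (Q : set U) : measurable Q -> mu Q \is a fin_num.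
Proof. by move=> mQ; exact: fin_num_measure. Qed.

Let indep_rect k A B E : (k < m)%N -> indep_at k ->
  measurable A -> measurable B -> (forall j, measurable (E j)) ->
  (forall j, (j < k.+1)%N -> E j = setT) ->
  P (step k @^-1` (A `*` B) `&` box E) =
  P (chain k @^-1` A) * mu B * \prod_(j < m) mu (E j).
Proof.
move=> km ik mA mB mE ET.
pose E' j := if j == k then B else E j.
have -> : step k @^-1` (A `*` B) `&` box E = chain k @^-1` A `&` box E'.
  apply/seteqP; split => w /=.
    move=> [[Aw Bw] Ew]; split => // j jm; rewrite /= /E'.
    by case: eqP => [->//|_]; exact: Ew.
  move=> [Aw Ew]; split; first split => //.
    by have := Ew k km; rewrite /= /E' eqxx.
  move=> j jm /=; have := Ew j jm; rewrite /= /E'.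
  by case: eqP => [->|//]; rewrite ET.
rewrite ik//; last 2 first.
- by move=> j; rewrite /E'; case: ifP.
- by move=> j jk; rewrite /E' ltn_eqF// ET// ltnW.
rewrite (bigD1 (Ordinal km))//= [in RHS](bigD1 (Ordinal km))//=.
rewrite /E' eqxx ET// probability_setT mul1e muleA; congr (_ * _).
by apply: eq_bigr => j jk; rewrite -val_eqE/= in jk; rewrite (negbTE jk).
Qed.

(** The law of (state, next block) restricted to the box and the same law scaled by the product of
    the [mu (E j)] agree on rectangles, by the induction hypothesis. Hence they agree on the
    preimage of [A] under [F], which is the event about the next state. *)
Let indep_chain k : (k <= m)%N -> indep_at k.
Proof.
elim: k => [_|k IH km] A E mA mE ET.
  rewrite -[chain 0]/(cst y0) preimage_cst; case: ifP => _.
    by rewrite setTI probability_setT mul1e indepX.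
  by rewrite set0I measure0 mul0e.
have ik := IH (ltnW km).
have mC : measurable (F @^-1` A) by rewrite -[X in measurable X]setTI; exact: mF.
have mP : measurable_fun setT (step k) := measurable_step k.
pose c := fine (\prod_(j < m) mu (E j)).
have cE : c%:E = \prod_(j < m) mu (E j).
  by rewrite fineK//; apply: prode_fin_num => j _; exact: probT.
have c0 : (0 <= c)%R by rewrite fine_ge0// prode_ge0.
have mB := measurable_box mE.
pose m1f : {measure set (V * U) -> \bar R} := pushforward (mrestr P mB) (step k).
pose m2f : {measure set (V * U) -> \bar R} :=
  mscale (NngNum c0) (pushforward P (step k)).
pose m1 := m1f mP; pose m2 := m2f mP.
have m12 : m1 (F @^-1` A) = m2 (F @^-1` A).
  apply: finite_prod_measure_ext => //.
    rewrite -[m1 setT]/(P (setT `&` box E)) setTI.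
    by rewrite ltey_eq fin_num_measure.
  move=> A' B' mA' mB'.
  transitivity (P (chain k @^-1` A') * mu B' * \prod_(j < m) mu (E j)).
    exact: indep_rect.
  rewrite -[m2 _]/(c%:E * P (step k @^-1` (A' `*` B'))) cE muleC; congr (_ * _).
  have := @indep_rect k A' B' (fun=> setT) km ik mA' mB'.
  have -> : box (fun=> setT) = setT by apply/seteqP; split => // w _ j _.
  rewrite setIT big1 ?mule1; last by move=> j _; exact: probability_setT.
  by move=> ->.
rewrite (_ : P _ = m1 (F @^-1` A))// m12.
by rewrite -[m2 _]/(c%:E * P (step k @^-1` (F @^-1` A))) cE muleC.
Qed.

(** The state and the next block have a product law, so Tonelli integrates the block first, with the
    state frozen; this stands in for conditional expectation and is why the drift is assumed at
    every [v]. *)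
Lemma expectation_chain_le (Psi : V -> R) (rho : R) k :
  measurable_fun setT Psi -> (forall v, 0 <= Psi v)%R -> (0 <= rho)%R ->
  (forall v, \int[mu]_b (Psi (F (v, b)))%:E <= (rho * Psi v)%:E) ->
  (k <= m)%N -> \int[P]_w (Psi (chain k w))%:E <= (rho ^+ k * Psi y0)%:E.
Proof.
move=> mPsi Psi0 rho0 drift; elim: k => [_|k IH km].
  rewrite /= integral_cst// expr0 mul1r.
  by rewrite [X in _ * X](@probability_setT _ _ _ P) mule1.
have mY := measurable_chain k.
pose Y : {mfun T >-> V} := HB.pack (chain k) (isMeasurableFun.Build _ _ _ _ _ mY).
pose law : probability V R := distribution P Y.
have mf : measurable_fun setT (fun vb : V * U => (Psi (F vb))%:E).
  by apply/measurable_EFinP; exact: measurableT_comp.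
have lawE C : measurable C ->
    pushforward P (step k) C = (law \x mu) C.
  move=> mC; have mP := measurable_step k.
  pose m1f : {measure set (V * U) -> \bar R} := pushforward P (step k).
  pose m1 := m1f mP.
  apply: (@finite_prod_measure_ext m1) => //.
    by rewrite -[m1 setT]/(P setT) ltey_eq fin_num_measure.
  move=> A B mA mB.
  apply: etrans; last by symmetry; exact: product_measure1E.
  have := @indep_rect k A B (fun=> setT) km (indep_chain (ltnW km)) mA mB.
  have -> : box (fun=> setT) = setT by apply/seteqP; split => // w _ j _.
  rewrite setIT big1 ?mule1; last by move=> j _; exact: probability_setT.
  by move=> h; exact: h.
have -> : \int[P]_w (Psi (chain k.+1 w))%:E =
    \int[law \x mu]_vb (Psi (F vb))%:E.
  have -> : \int[P]_w (Psi (chain k.+1 w))%:E =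
      \int[pushforward P (step k)]_vb (Psi (F vb))%:E.
    by rewrite ge0_integral_pushforward//; move=> ? _; rewrite lee_fin.
  apply: eq_measure_integral => C mC _; exact: lawE.
rewrite fubini_tonelli1//; last by move=> ?; rewrite lee_fin.
apply: le_trans (_ : \int[law]_v (rho * Psi v)%:E <= _).
  apply: ge0_le_integral => //.
  - by move=> v _; apply: integral_ge0 => b _; rewrite lee_fin.
  - apply: measurable_fun_fubini_tonelli_F => // ?; by rewrite lee_fin.
  - by apply/measurable_EFinP; exact: measurable_funM.
  - by move=> v _; exact: drift.
under eq_integral do rewrite EFinM.
have mEPsi : measurable_fun setT (EFin \o Psi) by exact/measurable_EFinP.
have EPsi0 v : 0 <= (EFin \o Psi) v by rewrite lee_fin.
have rho0' : 0 <= rho%:E by rewrite lee_fin.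
rewrite (ge0_integralZl law measurableT mEPsi (fun v _ => EPsi0 v) rho0').
rewrite (ge0_integral_distribution Y mEPsi EPsi0).
rewrite exprS -mulrA EFinM lee_wpmul2l ?lee_fin//; exact: IH (ltnW km).
Qed.

End markov_chain_of_iid.

Lemma markov_le (R : realType) d (T : measurableType d) (P : probability T R)
    (f : T -> R) (t e : R) : measurable_fun setT f -> (forall w, 0 <= f w) ->
  0 < t -> (\int[P]_w (f w)%:E <= e%:E)%E ->
  (P [set w | (t <= f w)%R] <= (e / t)%:E)%E.
Proof.
move=> mf f0 t0 fe.
have mEf : measurable_fun setT (EFin \o f) by exact/measurable_EFinP.
have := @le_integral_comp_abse _ T R P setT measurableT (EFin \o f) t id
  (@measurable_id _ _ _) (fun r r0 => r0) (fun _ _ _ _ xy => xy) mEf t0.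
rewrite setTI.
have -> : [set x | (t%:E <= `|(EFin \o f) x|)%E] = [set w | t <= f w].
  by apply/seteqP; split => w /=; rewrite lee_fin ger0_norm.
have -> : (\int[P]_x (id `|(EFin \o f) x|))%E = (\int[P]_w (f w)%:E)%E.
  by apply: eq_integral => w _; rewrite /= ger0_norm.
move=> /le_trans /(_ fe).
by rewrite EFinM lee_pdivlMr// muleC.
Qed.

(** * Measurable structure on the states of the recursion *)

HB.instance Definition _ (R : realType) (n : nat) := Choice.on (@gstate R n).
HB.instance Definition _ (R : realType) (n : nat) :=
  isPointed.Build (@gstate R n) (0, 0, 0).

Section measurable_state.
Context {R : realType} {n : nat}.
Local Notation C := R[i].

(** Generating the sigma-algebra by the real coordinates reduces measurability of maps into the
    state space to that of real functions. *)
Inductive gcoord : (@gstate R n -> R) -> Prop :=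
| gcoord_ure i : gcoord (fun st => complex.Re (st.1.1 i 0))
| gcoord_uim i : gcoord (fun st => complex.Im (st.1.1 i 0))
| gcoord_qre i j : gcoord (fun st => complex.Re (st.1.2 i j))
| gcoord_qim i j : gcoord (fun st => complex.Im (st.1.2 i j))
| gcoord_m : gcoord (fun st => st.2).

Definition gcylinders : set (set (@gstate R n)) :=
  [set E | exists f, gcoord f /\ exists2 A, measurable A & E = f @^-1` A].

Definition gstateM := g_sigma_algebraType gcylinders.

Lemma measurable_gcoord f : gcoord f -> measurable_fun setT (f : gstateM -> R).
Proof.
move=> cf _ A mA; rewrite setTI; apply: sub_sigma_algebra.
by exists f; split => //; exists A.
Qed.

Lemma measurable_to_gstate d (T : measurableType d) (X : T -> gstateM) :
  (forall f, gcoord f -> measurable_fun setT (f \o X)) -> measurable_fun setT X.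
Proof.
move=> h; apply: (@measurability _ _ _ gstateM setT X gcylinders) => //.
move=> _ [_ [f [cf [A mA ->]]] <-].
by apply: (h f cf).
Qed.

Lemma mxmeas_state_u d (T : measurableType d) (X : T -> gstateM) :
  measurable_fun setT X -> mxmeas setT (fun t => (X t).1.1).
Proof.
move=> mX i j; rewrite !ord1; split.
  exact: (measurableT_comp (measurable_gcoord (gcoord_ure i)) mX).
exact: (measurableT_comp (measurable_gcoord (gcoord_uim i)) mX).
Qed.

Lemma mxmeas_state_q d (T : measurableType d) (X : T -> gstateM) :
  measurable_fun setT X -> mxmeas setT (fun t => (X t).1.2).
Proof.
move=> mX i j; split.
  exact: (measurableT_comp (measurable_gcoord (gcoord_qre i j)) mX).
exact: (measurableT_comp (measurable_gcoord (gcoord_qim i j)) mX).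
Qed.

Lemma measurable_state_m d (T : measurableType d) (X : T -> gstateM) :
  measurable_fun setT X -> measurable_fun setT (fun t => (X t).2).
Proof. by move=> mX; exact: (measurableT_comp (measurable_gcoord gcoord_m) mX). Qed.

Lemma measurable_gstate_pair d (T : measurableType d) (u : T -> 'cV[C]_n)
    (Q : T -> 'M[C]_n) (M : T -> R) :
  mxmeas setT u -> mxmeas setT Q -> measurable_fun setT M ->
  measurable_fun setT (fun t => (u t, Q t, M t) : gstateM).
Proof.
move=> mu mQ mM; apply: measurable_to_gstate => f [i|i|i j|i j|].
- by have [] := mu i 0.
- by have [] := mu i 0.
- by have [] := mQ i j.
- by have [] := mQ i j.
- exact: mM.
Qed.

Variables (S : {set 'I_n}) (z : 'cV[C]_n) (g K : R).
Hypothesis g0 : 0 < g.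
Hypothesis K0 : 0 < K.

Section functions_of_state.
Context {d : measure_display} {T : measurableType d} (X : T -> gstateM).
Hypothesis mX : measurable_fun setT X.

Lemma mxmeas_resid : mxmeas setT (fun t => resid S z (X t).1.1).
Proof.
apply: mxmeasM; first exact: mxmeas_cst.
by apply: mxmeasD; [exact: mxmeas_cst | apply/mxmeasN/mxmeas_state_u].
Qed.

Lemma measurable_ynorm : measurable_fun setT (fun t => ynorm S z (X t).1.1).
Proof.
by apply: measurable_funM => //; apply: measurable_l2norm; exact: mxmeas_resid.
Qed.

Lemma measurable_eta : measurable_fun setT (fun t => eta S z g K (X t).1.1).
Proof.
apply: measurable_fun_inv => [t|]; first by rewrite -invr_gt0 eta_gt0.
apply: measurable_funM => //; apply: measurable_funD => //.
by apply: measurable_funM => //; exact: measurable_ynorm.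
Qed.

Lemma mxmeas_prjQ : mxmeas setT (fun t => prj S *m (X t).1.2).
Proof. by apply: mxmeasM; [exact: mxmeas_cst | exact: mxmeas_state_q]. Qed.

Lemma measurable_potQ : measurable_fun setT (fun t => potQ S z K (X t)).
Proof.
apply: measurable_funM; first by apply: measurable_frob; exact: mxmeas_prjQ.
by apply: measurableT_comp => //; apply: measurable_funM => //; exact: measurable_ynorm.
Qed.

Lemma measurable_potC : measurable_fun setT (fun t => potC S (X t)).
Proof.
apply: measurable_funD.
  by apply: measurableT_comp => //; exact: measurable_state_m.
apply: measurable_funM => //; apply: measurable_fun_sqrt.
by apply: measurable_frob; exact: mxmeas_prjQ.
Qed.

Lemma measurable_potU c : measurable_fun setT (fun t => potU S z K c (X t)).
Proof.
rewrite /potU; apply: measurableT_comp => //; apply: measurable_funD.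
  apply: measurable_funM => //; apply: measurable_rdot; first exact: mxmeas_cst.
  exact: mxmeas_state_u.
by apply: measurable_funM => //; exact: measurable_ynorm.
Qed.

Lemma measurable_gstep (G : T -> 'M[C]_n) : mxmeas setT G ->
  measurable_fun setT (fun t => gstep S z g K (X t) (G t) : gstateM).
Proof.
move=> mG; apply: measurable_gstate_pair.
- apply: mxmeasD; first exact: mxmeas_state_u.
  by apply: mxmeasZ; [exact: measurable_eta | exact: mxmeasM mxmeas_resid].
- apply: mxmeasD; first exact: mxmeas_prjQ.
  apply: mxmeasN; apply: mxmeasZ; first exact: measurable_eta.
  apply: mxmeasM; last exact: mxmeas_prjQ.
  by apply: mxmeasM => //; exact: mxmeas_cst.
- apply: measurable_funD; first exact: measurable_state_m.
  apply: measurable_funM; last exact: measurable_retr.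
  apply: measurable_funM; first exact: measurable_eta.
  by apply: measurable_fun_sqrt; apply: measurable_frob; exact: mxmeas_prjQ.
Qed.

End functions_of_state.
End measurable_state.
Arguments gstateM : clear implicits.

(** * Consequences of isotropy and of the coherence bounds *)

Section support_matrix.
Context {R : realType} {n : nat}.
Variable S : {set 'I_n}.
Local Notation C := R[i].
Local Notation Ps := (@support_mx R n S).

Lemma support_mxK : Ps *m Ps ^t* = prj S.
Proof.
apply/matrixP => i j; rewrite !mxE.
under eq_bigr do rewrite !mxE eqxx !andbT conjC_nat.
have [iS|iS] := boolP (i \in S); rewrite ?andbT ?andbF.
  rewrite (bigD1 (enum_rank_in iS i))//= enum_rankK_in// eqxx mul1r.
  rewrite eq_sym big1 ?addr0// => k ki.
  case: eqP => [ik|_]; last by rewrite mul0r.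
  by case/eqP: ki; apply: enum_val_inj; rewrite enum_rankK_in.
rewrite big1// => k _; case: eqP => [ik|_]; last by rewrite mul0r.
by move: iS; rewrite ik enum_valP.
Qed.

Lemma l2norm_support_adj (a : 'cV[C]_n) :
  l2norm (Ps ^t* *m a) = l2norm (prj S *m a).
Proof.
rewrite !l2norm_rdot; congr Num.sqrt.
by rewrite rdot_adjoint mulmxA support_mxK rdot_prj_prj.
Qed.

Lemma opnorm_contracting p (B : 'M[C]_(p, n)) (g : R) (a : 'cV[C]_n) :
  0 <= g -> opnorm ((restr_mx B S) ^t* *m restr_mx B S) <= g ->
  prj S *m a = a -> contracting S g (gram B) a.
Proof.
move=> g0 Bg aS.
have le1 (c : 'cV[C]_n) : prj S *m c = c ->
    l2norm (prj S *m (gram B *m c)) <= g * l2norm c.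
  move=> cS; rewrite -l2norm_support_adj.
  have -> : Ps ^t* *m (gram B *m c) =
      ((restr_mx B S) ^t* *m restr_mx B S) *m (Ps ^t* *m c).
    by rewrite /restr_mx trmx_mul map_mxM -{1}cS -support_mxK /gram !mulmxA.
  apply: le_trans (opnormP _ _) _; rewrite l2norm_support_adj cS.
  by rewrite ler_wpM2r// l2norm_ge0.
have le2 (c : 'cV[C]_n) : prj S *m c = c ->
    rdot c (gram B *m c) <= g * rdot c c.
  move=> cS; rewrite -{1}cS rdot_prj -sqr_l2norm expr2 mulrA.
  apply: le_trans (ler_norm _) _; apply: le_trans (rdot_le _ _) _.
  by rewrite mulrC ler_wpM2r ?l2norm_ge0// le1.
split; [by rewrite rdot_gram | exact: le2 |].
(* Here [||t||^2 = rdot (B t) (B a)]. Cauchy-Schwarz and the second clause at [t] give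
   [||t||^4 <= g ||t||^2 rdot a (G a)]; one factor [||t||^2] cancels. *)
set t := prj S *m (gram B *m a).
have tS : prj S *m t = t by rewrite /t mulmxA prjK.
have [t0|tN0] := eqVneq (rdot t t) 0.
  by rewrite t0 mulr_ge0// rdot_gram.
have tp : 0 < rdot t t by rewrite lt_neqAle eq_sym tN0 rdot_ge0.
have ttE : rdot t t = rdot (B *m t) (B *m a).
  by rewrite -rdot_gram /t rdot_prj_prj.
clearbody t.
have := rdot_cauchy_schwarz (B *m t) (B *m a); rewrite -ttE -!rdot_gram => cs.
have := ler_wpM2r (rdot_ge0 (B *m a)) (le2 _ tS); rewrite -rdot_gram => cs2.
rewrite expr2 in cs; rewrite -(ler_pM2l tp); lra.
Qed.

End support_matrix.

(** * Integrable variables with known mean *)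

Section means.
Context {R : realType} {d : measure_display} {T : measurableType d}.
Variable P : probability T R.
Local Notation C := R[i].
Local Open Scope ereal_scope.

Definition has_mean (f : T -> R) (e : R) : Prop :=
  P.-integrable setT (EFin \o f) /\ \int[P]_w (f w)%:E = e%:E.

Lemma has_mean_measurable f e : has_mean f e -> measurable_fun setT f.
Proof. by move=> [/integrableP[/measurable_EFinP]]. Qed.

Lemma has_meanD f h e r : has_mean f e -> has_mean h r ->
  has_mean (fun w => f w + h w)%R (e + r)%R.
Proof.
move=> [fi fe] [hi hr]; split.
  have -> : EFin \o (fun w => f w + h w)%R = (EFin \o f) \+ (EFin \o h) by [].
  exact: integrableD.
by under eq_integral do rewrite EFinD; rewrite integralD//= fe hr.
Qed.

Lemma has_meanZ f e k : has_mean f e -> has_mean (fun w => k * f w)%R (k * e)%R.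
Proof.
move=> [fi fe]; split.
  have -> : EFin \o (fun w => k * f w)%R = (fun w => k%:E * (EFin \o f) w) by [].
  exact: integrableZl.
by under eq_integral do rewrite EFinM; rewrite integralZl//= fe.
Qed.

Lemma has_mean_cst e : has_mean (fun _ => e) e.
Proof.
split; first exact: finite_measure_integrable_cst.
by rewrite integral_cst// [X in _ * X](@probability_setT _ _ _ P) mule1.
Qed.

Lemma has_mean_sum (I : Type) (s : seq I) (f : I -> T -> R) (e : I -> R) :
  (forall i, has_mean (f i) (e i)) ->
  has_mean (fun w => \sum_(i <- s) f i w)%R (\sum_(i <- s) e i)%R.
Proof.
move=> fe; elim: s => [|i s IH].
  by rewrite big_nil; under eq_fun do rewrite big_nil; exact: has_mean_cst.
by rewrite big_cons; under eq_fun do rewrite big_cons; exact: has_meanD.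
Qed.

Lemma has_mean_eq (f h : T -> R) e r : f =1 h -> e = r -> has_mean f e -> has_mean h r.
Proof. by move=> /funext -> ->. Qed.

Lemma integrable_has_mean (f : T -> R) : P.-integrable setT (EFin \o f) ->
  has_mean f (fine (\int[P]_w (f w)%:E)).
Proof. by move=> fi; split => //; rewrite fineK// integrable_fin_num. Qed.

Lemma ae_le_mean (f h : T -> R) (e : R) : measurable_fun setT f -> (forall w, 0 <= f w)%R ->
  has_mean h e -> (\forall w \ae P, (f w <= h w)%R) ->
  \int[P]_w (f w)%:E <= e%:E.
Proof.
move=> mf f0 [hi he] fh; have mh := has_mean_measurable (conj hi he).
(* [h] may be negative on the null set where the comparison fails; truncation at 0 repairs this
   without changing the integral. *)
rewrite -he; apply: le_trans (_ : \int[P]_w (Num.max (h w) 0)%:E <= _).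
  apply: ae_ge0_le_integral => //.
  - by move=> w _; rewrite lee_fin.
  - exact/measurable_EFinP.
  - by move=> w _; rewrite lee_fin le_max lexx orbT.
  - by apply/measurable_EFinP; exact: measurable_maxr.
  - by apply: filterS fh => w fw _; rewrite lee_fin le_max fw.
rewrite le_eqVlt; apply/orP; left; apply/eqP; apply: ae_eq_integral => //.
- by apply/measurable_EFinP; exact: measurable_maxr.
- exact/measurable_EFinP.
- by apply: filterS fh => w fw _; congr EFin; apply/max_idPl; exact: le_trans fw.
Qed.

Lemma ae_bounded_integrable (f : T -> R) (b : R) : measurable_fun setT f ->
  (\forall w \ae P, (`|f w| <= b)%R) -> P.-integrable setT (EFin \o f).
Proof.
move=> mf fb; apply/integrableP; split; first exact/measurable_EFinP.
apply: le_lt_trans (ltry b).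
apply: (ae_le_mean (f := fun w => `|f w|%R) _ _ (has_mean_cst b)) => //.
exact: measurableT_comp.
Qed.

Definition entries_integrable p q (X : T -> 'M[C]_(p, q)) : Prop :=
  forall k l, P.-integrable setT (EFin \o (fun w => complex.Re (X w k l))) /\
              P.-integrable setT (EFin \o (fun w => complex.Im (X w k l))).

Lemma has_mean_rdot p q (X : T -> 'M[C]_(p, q)) a b : entries_integrable X ->
  has_mean (fun w => rdot a (X w *m b)) (rdot a (expect_mx P X *m b)).
Proof.
move=> iX.
have E (Y : 'M[C]_(p, q)) : rdot a (Y *m b) = (\sum_k \sum_l
    ((complex.Re (a k 0%R) * complex.Re (b l 0%R) +
      complex.Im (a k 0%R) * complex.Im (b l 0%R)) * complex.Re (Y k l) +
     (complex.Im (a k 0%R) * complex.Re (b l 0%R) -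
      complex.Re (a k 0%R) * complex.Im (b l 0%R)) * complex.Im (Y k l)))%R.
  apply: eq_bigr => k _; rewrite mxE re_sum im_sum !mulr_sumr -big_split/=.
  by apply: eq_bigr => l _; rewrite re_mul im_mul; ring.
rewrite E; under eq_fun do rewrite E.
apply: has_mean_sum => k; apply: has_mean_sum => l.
have [ire iim] := iX k l.
by apply: has_meanD; apply: has_meanZ; rewrite mxE/= unlock;
  exact: integrable_has_mean.
Qed.

End means.

Section gram_entries.
Context {R : realType} {n : nat}.
Local Notation C := R[i].

Lemma adjK p q (A : 'M[C]_(p, q)) : (A ^t*) ^t* = A.
Proof. by apply/matrixP => i j; rewrite !mxE conjCK. Qed.

Definition unitv (i : 'I_n) : 'cV[C]_n := delta_mx i 0.

Lemma rdot_unitv i : rdot (unitv i) (unitv i) = 1.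
Proof.
rewrite rdotE (bigD1 i)//= mxE !eqxx Normc.normc1 expr1n big1 ?addr0// => k ki.
by rewrite mxE (negbTE ki) Normc.normc0 expr0n.
Qed.

Lemma prj_unitv (S : {set 'I_n}) i : i \in S -> prj S *m unitv i = unitv i.
Proof.
move=> iS; apply/colP => k; rewrite prjE; case: ifPn => // kS.
by rewrite mxE; case: eqP => [ki|//]; rewrite ki iS in kS.
Qed.

Lemma rdotZ_unit p (t : C) (a : 'cV[C]_p) : Normc.normc t = 1 ->
  rdot (t *: a) (t *: a) = rdot a a.
Proof. by move=> t1; rewrite -!sqr_l2norm l2normZ t1 mul1r. Qed.

Lemma rdot_amgm p (a b : 'cV[C]_p) : `|rdot a b| <= rdot a a + rdot b b.
Proof.
rewrite ler_norml; have := rdot_ge0 (a + b); have := rdot_ge0 (a - b).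
have := rdot_ge0 a; have := rdot_ge0 b.
rewrite !rdotDr !rdotNr !rdotDl !rdotNl (rdotC b a) => ? ? ? ?.
by apply/andP; split; lra.
Qed.

Lemma normc_i : Normc.normc ('i : C) = 1.
Proof. by rewrite /= expr0n add0r expr1n sqrtr1. Qed.

Lemma re_gram p (B : 'M[C]_(p, n)) j k :
  complex.Re (gram B j k) = rdot (col j B) (col k B).
Proof.
rewrite mxE re_sum; apply: eq_bigr => l _.
by rewrite !mxE re_mul re_conj im_conj; ring.
Qed.

Lemma im_gram p (B : 'M[C]_(p, n)) j k :
  complex.Im (gram B j k) = rdot ('i *: col j B) (col k B).
Proof.
rewrite mxE im_sum; apply: eq_bigr => l _.
by rewrite !mxE im_mul re_mul im_mul re_conj im_conj /=; ring.
Qed.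

Lemma gram_entry_le p (B : 'M[C]_(p, n)) j k :
  `|complex.Re (gram B j k)| <=
    complex.Re (gram B j j) + complex.Re (gram B k k) /\
  `|complex.Im (gram B j k)| <=
    complex.Re (gram B j j) + complex.Re (gram B k k).
Proof.
rewrite !re_gram im_gram; split; first exact: rdot_amgm.
by rewrite -(rdotZ_unit (col j B) normc_i); exact: rdot_amgm.
Qed.

Lemma retr_sum p (B : 'M[C]_(p, n)) :
  retr (gram B) = \sum_j rdot (unitv j) (gram B *m unitv j).
Proof.
rewrite retr_gram; apply: eq_bigr => j _.
by rewrite rdot_gram -!colE.
Qed.

End gram_entries.

Section random_gram.
Context {R : realType} {n : nat} {d0 : measure_display} {T0 : measurableType d0}.
Context {P0 : probability T0 R}.
Variable B : {RV P0 >-> blockType R n}.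
Local Notation C := R[i].
Let G (w : T0) : 'M[C]_n := gram (block_val (B w)).

Lemma mxmeas_random_gram : mxmeas setT G.
Proof.
move=> i j; have [m1 m2] := @mxmeas_gram R n i j.
by split; [apply: (measurableT_comp m1) | apply: (measurableT_comp m2)].
Qed.

Lemma measurable_rdot_gram a b : measurable_fun setT (fun w => rdot a (G w *m b)).
Proof.
apply: measurable_rdot; first exact: mxmeas_cst.
by apply: mxmeasM; [exact: mxmeas_random_gram | exact: mxmeas_cst].
Qed.

Hypothesis isoB : isotropic B.

Let gram_diag_mean j : has_mean P0 (fun w => complex.Re (G w j j)) 1.
Proof.
have mf : measurable_fun setT (fun w => complex.Re (G w j j)).
  by have [] := mxmeas_random_gram j j.
have f0 w : 0 <= complex.Re (G w j j) by rewrite re_gram.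
have int1 : (\int[P0]_w (complex.Re (G w j j))%:E = 1%:E)%E.
  have := congr1 (fun M : 'M[C]_n => complex.Re (M j j)) isoB.
  rewrite !mxE eqxx /= unlock.
  have : (0 <= \int[P0]_w (complex.Re (G w j j))%:E)%E.
    by apply: integral_ge0 => w _; rewrite lee_fin.
  (* [fine] sends infinite values to 0, so the diagonal entry 1 in the isotropy condition forces a
     finite integral. *)
  rewrite /G /gram; case: (integral _ _ _) => [r _ /= -> //|_ /= /esym/eqP|//].
  by rewrite oner_eq0.
split=> //; apply/integrableP; split; first exact/measurable_EFinP.
rewrite (eq_integral (fun w => (complex.Re (G w j j))%:E)); last first.
  by move=> w _; rewrite /= ger0_norm.
by rewrite int1 ltry.
Qed.

(** Every entry is dominated by the sum of two diagonal ones, which are nonnegative with mean 1. *)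
Lemma entries_integrable_gram : entries_integrable P0 G.
Proof.
move=> j k; have [m1 m2] := mxmeas_random_gram j k.
have [iD _] := has_meanD (gram_diag_mean j) (gram_diag_mean k).
have D0 w : 0 <= complex.Re (G w j j) + complex.Re (G w k k).
  by rewrite addr_ge0// re_gram.
split; apply: (le_integrable measurableT _ _ iD); try exact/measurable_EFinP.
- move=> w _; rewrite /= lee_fin [leRHS]ger0_norm//.
  by have [] := gram_entry_le (block_val (B w)) j k.
- move=> w _; rewrite /= lee_fin [leRHS]ger0_norm//.
  by have [] := gram_entry_le (block_val (B w)) j k.
Qed.

Lemma has_mean_rdot_gram a b : has_mean P0 (fun w => rdot a (G w *m b)) (rdot a b).
Proof.
have := has_mean_rdot a b entries_integrable_gram.
have -> : expect_mx P0 G = 1%:M by exact: isoB.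
by rewrite mul1mx.
Qed.

Lemma has_mean_retr : has_mean P0 (fun w => retr (G w)) n%:R.
Proof.
apply: (has_mean_eq (f := fun w => \sum_j rdot (unitv j) (G w *m unitv j))
  (e := \sum_(j < n) rdot (unitv j) (unitv j))).
- by move=> w; rewrite /G retr_sum.
- under eq_bigr do rewrite rdot_unitv.
  by rewrite sumr_const card_ord.
- by apply: has_mean_sum => j; exact: has_mean_rdot_gram.
Qed.

Lemma has_mean_qdrop (S : {set 'I_n}) Q :
  has_mean P0 (fun w => qdrop S Q (G w)) (frob (prj S *m Q)).
Proof. by apply: has_mean_sum => j; exact: has_mean_rdot_gram. Qed.

Section coherence_bounds.
Variables (S : {set 'I_n}) (mu1 mu2 mu3 g : R).
Hypothesis mu1P : is_mu1 B S mu1.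
Hypothesis mu2P : is_mu2 B S mu2.
Hypothesis mu3P : is_mu3 B S mu3.
Hypothesis mu1g : mu1 <= g.
Hypothesis mu2g : mu2 <= g.
Hypothesis mu3g : mu3 <= g.
Hypothesis S0 : (0 < #|S|)%N.
Local Notation s := (Num.sqrt (#|S|%:R : R)).

Let s_gt0 : 0 < s. Proof. by rewrite sqrtr_gt0 ltr0n. Qed.

Let g_ge0 : 0 <= g. Proof. by case: mu1P => mu0 _ _; exact: le_trans mu1g. Qed.

Lemma ae_contracting a : prj S *m a = a ->
  \forall w \ae P0, contracting S g (G w) a.
Proof.
move=> aS; case: mu1P => _ ae1 _; apply: filterS ae1 => w le1.
by apply: opnorm_contracting => //; exact: le_trans mu1g.
Qed.

(** For [i] in [S], [rdot e_i (G e_i)] has mean 1 by isotropy and is almost surely at most [g]. *)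
Lemma gamma_ge1 : 1 <= g.
Proof.
have /card_gt0P[i iS] := S0.
have /ae_contracting aei := prj_unitv (R := R) iS.
have [_ e1] := has_mean_rdot_gram (unitv i) (unitv i).
rewrite -lee_fin -(rdot_unitv (R := R) i) -e1.
apply: ae_le_mean (has_mean_cst P0 g) _.
- exact: measurable_rdot_gram.
- by move=> w; rewrite rdot_gram.
- by apply: filterS aei => w [_ + _]; rewrite rdot_unitv mulr1.
Qed.

Let coltau i (w : T0) : 'cV[C]_#|S| :=
  (restr_mx (block_val (B w)) S) ^t* *m (block_val (B w) *m canon_vec i).

Let rdot_coltau i t (a : 'cV[C]_n) w : prj S *m a = a ->
  rdot (t *: unitv i) (G w *m a) =
  rdot (t *: coltau i w) ((support_mx S) ^t* *m a).
Proof.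
move=> aS.
have -> : t *: coltau i w = (support_mx S) ^t* *m (G w *m (t *: unitv i)).
  by rewrite /coltau /restr_mx trmx_mul map_mxM /G /gram -!scalemxAr !mulmxA.
rewrite rdot_adjoint [support_mx S *m _]mulmxA support_mxK rdot_prj aS.
by rewrite [RHS]rdotC /G !rdot_gram rdotC.
Qed.

Lemma ae_offsupport_le i t a : i \notin S -> Normc.normc t = 1 ->
  prj S *m a = a ->
  \forall w \ae P0, `|rdot (t *: unitv i) (G w *m a)| <= g * (l2norm a / s).
Proof.
move=> iS t1 aS; case: mu2P => _ ae2 _; apply: filterS ae2 => w le2.
rewrite rdot_coltau//; apply: le_trans (rdot_le _ _) _.
rewrite l2norm_support_adj aS l2normZ t1 mul1r mulrCA [leRHS]mulrC.
rewrite ler_wpM2r ?l2norm_ge0// ler_pdivlMr// mulrC.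
apply: le_trans mu2g; apply: le_trans le2.
rewrite ler_wpM2l ?(ltW s_gt0)//.
by apply: (le_bigmax_cond _ (fun i => l2norm (coltau i w))); rewrite inE.
Qed.

(** [mu3] controls a squared modulus, whereas the martingale increments are real parts; hence a
    majorant [m] of known mean in place of the square itself. *)
Lemma offsupport_second_moment i t a : i \notin S -> Normc.normc t = 1 ->
  prj S *m a = a ->
  exists m e, [/\ has_mean P0 m e, e <= g * (l2norm a / s) ^+ 2 &
    forall w, rdot (t *: unitv i) (G w *m a) ^+ 2 <= m w].
Proof.
move=> iS t1 aS.
pose W w := (restr_mx (block_val (B w)) S) ^t* *m (block_val (B w) *m canon_vec i)
  *m (block_val (B w) *m canon_vec i) ^t* *m restr_mx (block_val (B w)) S.
have WE w : W w = coltau i w *m (coltau i w) ^t*.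
  rewrite /W /coltau; set A := restr_mx _ _; set b := _ *m canon_vec i.
  by clearbody A b; rewrite trmx_mul map_mxM adjK mulmxA.
have mtau : mxmeas setT (coltau i).
  have -> : coltau i = fun w => (support_mx S) ^t* *m (G w *m canon_vec i).
    apply/funext => w.
    by rewrite /coltau /restr_mx trmx_mul map_mxM /G /gram !mulmxA.
  apply: mxmeasM; first exact: mxmeas_cst.
  by apply: mxmeasM; [exact: mxmeas_random_gram | exact: mxmeas_cst].
have mW : mxmeas setT W.
  have -> : W = fun w => coltau i w *m (coltau i w) ^t* by apply/funext.
  by apply: mxmeasM => //; exact: mxmeas_adjoint.
(* [mu2] makes the entries of [W] almost surely bounded, so that [expect_mx] in the definition of
   [mu3] is a genuine mean. *)
have iW : entries_integrable P0 W.
  have aeb : \forall w \ae P0, rdot (coltau i w) (coltau i w) <= (g / s) ^+ 2.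
    case: mu2P => _ ae2 _; apply: filterS ae2 => w le2.
    rewrite -sqr_l2norm ler_pXn2r ?nnegrE ?l2norm_ge0 ?divr_ge0 ?(ltW s_gt0)//.
    rewrite ler_pdivlMr// mulrC.
    apply: le_trans mu2g; apply: le_trans le2; rewrite ler_wpM2l ?(ltW s_gt0)//.
    by apply: (le_bigmax_cond _ (fun i => l2norm (coltau i w))); rewrite inE.
  move=> k l; have [m1 m2] := mW k l.
  have bnd w : Normc.normc (W w k l) <= rdot (coltau i w) (coltau i w).
    rewrite WE; move: (coltau i w) => v; rewrite mxE big_ord1 !mxE Normc.normcM.
    set x := v k 0; set y := v l 0.
    have -> : Normc.normc (Num.conj y) = Normc.normc y.
      by case: y => y1 y2 /=; rewrite sqrrN.
    have le (j : 'I_#|S|) :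
        Normc.normc (v j 0) <= l2norm v.
      rewrite -(@ler_pXn2r _ 2)// ?nnegrE ?l2norm_ge0 ?normc_ge0//.
      rewrite sqr_l2norm rdotE (bigD1 j)//= lerDl sumr_ge0// => ? _.
      exact: sqr_ge0.
    by rewrite -sqr_l2norm expr2 ler_pM ?normc_ge0 ?le.
  have re_le (c : C) : `|complex.Re c| <= Normc.normc c /\
      `|complex.Im c| <= Normc.normc c.
    by split; rewrite -(@ler_pXn2r _ 2)// ?nnegrE ?normc_ge0//
      real_normK ?num_real// normc_sqr ?lerDl ?lerDr sqr_ge0.
  by split; apply: (ae_bounded_integrable (b := (g / s) ^+ 2)) => //;
    apply: filterS aeb => w; apply: le_trans; apply: le_trans (bnd w);
    case: (re_le (W w k l)).
pose b := (support_mx S) ^t* *m a.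
exists (fun w => rdot b (W w *m b)), (rdot b (expect_mx P0 W *m b)).
split; first exact: has_mean_rdot.
- case: mu3P => _ le3 _.
  have opW : #|S|%:R * opnorm (expect_mx P0 W) <= g.
    apply: le_trans mu3g; apply: le_trans le3; rewrite ler_wpM2l ?ler0n//.
    apply: (le_bigmax_cond _ (fun i => opnorm (expect_mx P0 (fun w =>
      (restr_mx (block_val (B w)) S) ^t* *m (block_val (B w) *m canon_vec i) *m
      (block_val (B w) *m canon_vec i) ^t* *m restr_mx (block_val (B w)) S)))).
    by rewrite inE.
  have ba : l2norm b = l2norm a by rewrite /b l2norm_support_adj aS.
  apply: le_trans (ler_norm _) _; apply: le_trans (rdot_le _ _) _.
  apply: le_trans (ler_wpM2l (l2norm_ge0 _) (opnormP _ _)) _.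
  have -> : g * (l2norm a / s) ^+ 2 = l2norm b * (g / #|S|%:R * l2norm b).
    rewrite ba expr_div_n (sqr_sqrtr (ler0n R #|S|)).
    by move: (l2norm a) (#|S|%:R^-1 : R) => A N; ring.
  apply: ler_wpM2l; first exact: l2norm_ge0.
  apply: ler_wpM2r; first exact: l2norm_ge0.
  by rewrite ler_pdivlMr ?ltr0n// mulrC.
- move=> w; rewrite rdot_coltau// -/b WE -mulmxA; clearbody b.
  rewrite -[X in X *m (_ *m b)]adjK rdot_adjoint.
  set c := (coltau i w) ^t* *m b.
  have -> : rdot (t *: coltau i w) b = rdot (t%:M : 'cV[C]_1) c.
    rewrite /c rdot_adjoint mul_mx_scalar//.
  apply: le_trans (rdot_cauchy_schwarz _ _) _.
  have -> : rdot (t%:M : 'cV[C]_1) t%:M = 1.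
    by rewrite rdotE big_ord1 mxE eqxx mulr1n t1 expr1n.
  by rewrite mul1r.
Qed.

End coherence_bounds.
End random_gram.

(** * Supermartingale property of the potentials *)

Section drift.
Context {R : realType} {n : nat} {d0 : measure_display} {T0 : measurableType d0}.
Context {P0 : probability T0 R}.
Variable B : {RV P0 >-> blockType R n}.
Local Notation C := R[i].
Let G (w : T0) : 'M[C]_n := gram (block_val (B w)).
Variables (S : {set 'I_n}) (mu1 mu2 mu3 g K : R) (z : 'cV[C]_n).
Hypothesis isoB : isotropic B.
Hypothesis mu1P : is_mu1 B S mu1.
Hypothesis mu2P : is_mu2 B S mu2.
Hypothesis mu3P : is_mu3 B S mu3.
Hypothesis mu1g : mu1 <= g.
Hypothesis mu2g : mu2 <= g.
Hypothesis mu3g : mu3 <= g.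
Hypothesis S0 : (0 < #|S|)%N.
Hypothesis K0 : 0 < K.
Local Notation s := (Num.sqrt (#|S|%:R : R)).

Let g0 : 0 < g.
Proof. exact: lt_le_trans ltr01 (gamma_ge1 isoB mu1P mu1g S0). Qed.

Lemma potC_ge0 (st : @gstate R n) : 0 <= potC S st.
Proof. by rewrite addr_ge0// !mulr_ge0 ?sqrtr_ge0 ?ler0n. Qed.

Lemma potQ_ge0 (st : @gstate R n) : 0 <= potQ S z K st.
Proof. by rewrite mulr_ge0 ?frob_ge0 ?expR_ge0. Qed.

Lemma potU_ge0 c (st : @gstate R n) : 0 <= potU S z K c st.
Proof. exact: expR_ge0. Qed.

Let ae_cols Q : \forall w \ae P0, forall j, contracting S g (G w) (gcols S Q j).
Proof.
apply: filter_forall => j.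
by apply: (ae_contracting mu1P mu1g); exact: prj_gcols.
Qed.

Let ae_resid u : \forall w \ae P0, contracting S g (G w) (resid S z u).
Proof. by apply: (ae_contracting mu1P mu1g); exact: prj_resid. Qed.

Let measurable_next st :
  measurable_fun setT (fun w => gstep S z g K st (G w) : gstateM R n).
Proof.
apply: (measurable_gstep S z g0 K0 (X := cst (st : gstateM R n))).
  exact: measurable_cst.
exact: mxmeas_random_gram.
Qed.

Let has_mean_ydrop u :
  has_mean P0 (fun w => ydrop S z g K u (G w)) (eta S z g K u * ynorm S z u / 2).
Proof.
pose k := eta S z g K u / (2 * l2norm (resid S z u) * s).
apply: (has_mean_eq (f := fun w => k * rdot (resid S z u) (G w *m resid S z u))
  (e := k * rdot (resid S z u) (resid S z u))).
- by move=> w; rewrite /ydrop /k mulrAC.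
- rewrite /k /ynorm -sqr_l2norm.
  have [->|l0] := eqVneq (l2norm (resid S z u)) 0.
    by rewrite expr0n/= !mulr0 !mul0r mulr0 mul0r.
  have sN0 : s != 0 by rewrite sqrtr_eq0 -ltNge ltr0n.
  move: l0 sN0; move: (l2norm _) s => l s' l0 sN0.
  by field; rewrite l0 sN0.
- by apply: has_meanZ; exact: has_mean_rdot_gram.
Qed.

(** With [f] the Frobenius norm of the projected [Q], the mean growth [eta f n] of the third
    component balances exactly the mean decrease [(n eta / f) f^2] of [2 n f]; this fixes the factor
    [2 n] in [potC]. *)
Lemma drift_potC st :
  (\int[P0]_w (potC S (gstep S z g K st (G w)))%:E <= (potC S st)%:E)%E.
Proof.
set f := Num.sqrt (frob (prj S *m st.1.2)); set e := eta S z g K st.1.1.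
pose h w := potC S st + e * f * retr (G w) +
  (- (n%:R * e / f)) * qdrop S st.1.2 (G w).
have mh : has_mean P0 h (potC S st).
  apply: (has_mean_eq (f := h) (e := potC S st + e * f * n%:R +
      (- (n%:R * e / f)) * frob (prj S *m st.1.2))) => //.
    rewrite -[frob _]sqr_sqrtr ?frob_ge0// -/f.
    have [->|f0] := eqVneq f 0.
      by rewrite expr0n /= !mulr0 mul0r !addr0.
    by field.
  apply: has_meanD; last by apply: has_meanZ; exact: has_mean_qdrop.
  apply: has_meanD; first exact: has_mean_cst.
  by apply: has_meanZ; exact: has_mean_retr.
apply: ae_le_mean mh _.
- exact: measurable_potC (measurable_next st).
- by move=> w; exact: potC_ge0.
- apply: filterS (ae_cols st.1.2) => w cw.
  rewrite /h mulNr; apply: potC_step => //.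
  by rewrite /G retr_gram frob_ge0.
Qed.

(** The mean relative decrease is [e (1 + K y) / 2], at least [e (2 + K y) / 4 = 1 / (4 g)]. The
    part [K y] comes from the exponential factor and makes the rate uniform although steps are short
    while [y] is large. *)
Lemma drift_potQ st :
  (\int[P0]_w (potQ S z K (gstep S z g K st (G w)))%:E <=
   ((1 - (4 * g)^-1) * potQ S z K st)%:E)%E.
Proof.
set F := frob (prj S *m st.1.2); set e := eta S z g K st.1.1.
set y := ynorm S z st.1.1; set X := expR (2 * K * y).
pose h w := X * (F + (- (e / 2)) * qdrop S st.1.2 (G w) +
  (- (F * K)) * ydrop S z g K st.1.1 (G w)).
have mh : has_mean P0 h (X * (F + (- (e / 2)) * F + (- (F * K)) * (e * y / 2))).
  apply: has_meanZ; apply: has_meanD; last by apply: has_meanZ; exact: has_mean_ydrop.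
  apply: has_meanD; first exact: has_mean_cst.
  by apply: has_meanZ; exact: has_mean_qdrop.
apply: le_trans (_ : (X * (F + (- (e / 2)) * F + (- (F * K)) * (e * y / 2)))%:E <= _)%E.
  apply: ae_le_mean mh _.
  - exact: measurable_potQ (measurable_next st).
  - by move=> w; exact: potQ_ge0.
  - apply: filterS2 (ae_cols st.1.2) (ae_resid st.1.1) => w cw rw.
    by rewrite /h !mulNr; apply: potQ_step.
rewrite lee_fin /potQ -/F -/y -/X.
have eE : e * g * (2 + K * y) = 1 by exact: etaE.
have e0 : 0 < e by exact: eta_gt0.
have y0 : 0 <= y by exact: ynorm_ge0.
rewrite [leRHS](_ : _ = X * (F * (1 - (4 * g)^-1))); last by ring.
rewrite [leLHS](_ : _ = X * (F * (1 - e * (1 + K * y) / 2))); last by ring.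
rewrite !ler_wpM2l ?expR_ge0 ?frob_ge0// lerD2l lerN2.
rewrite invfM ler_pdivrMr// -(@ler_pM2l _ 4)//.
have : 0 <= e * g * (K * y) by apply: mulr_ge0; apply: mulr_ge0 => //; exact: ltW.
by rewrite mulfV//; lra.
Qed.

(** The linear term has mean 0, as [c] and the residual have disjoint supports. By [K e g y <= 1]
    the second-moment term is at most [6/2048 K e y], while the drop of [ynorm] brings
    [7/2048 K e y]. *)
Lemma drift_potU i t st : i \notin S -> Normc.normc t = 1 ->
  (\int[P0]_w (potU S z K (t *: unitv i) (gstep S z g K st (G w)))%:E <=
   (potU S z K (t *: unitv i) st)%:E)%E.
Proof.
move=> iS t1; set c := t *: unitv i; set v := resid S z st.1.1.
have vS : prj S *m v = v by exact: prj_resid.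
set e := eta S z g K st.1.1; set y := ynorm S z st.1.1.
have [m [em [mm emle rm]]] := offsupport_second_moment mu1P mu2P mu3P mu1g mu2g mu3g S0 iS t1 vS.
have cv0 : rdot c v = 0.
  rewrite -vS -rdot_prj (_ : prj S *m c = 0) ?rdot0l//.
  apply/colP => k; rewrite prjE !mxE; case: ifPn => // kS.
  by case: eqP => [ki|]; rewrite ?mulr0//; rewrite -ki kS in iS.
set X := potU S z K c st.
pose h w := X * (1 + K / 32 * e * rdot c (G w *m v) +
  (- (K / 128 - K / 1024)) * ydrop S z g K st.1.1 (G w) +
  3 * (K / 32 * e) ^+ 2 * m w).
have mh : has_mean P0 h (X * (1 + K / 32 * e * rdot c v +
    (- (K / 128 - K / 1024)) * (e * y / 2) + 3 * (K / 32 * e) ^+ 2 * em)).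
  apply: has_meanZ; apply: has_meanD; last by apply: has_meanZ.
  apply: has_meanD; last by apply: has_meanZ; exact: has_mean_ydrop.
  apply: has_meanD; first exact: has_mean_cst.
  by apply: has_meanZ; exact: has_mean_rdot_gram.
apply: le_trans (_ : (X * (1 + K / 32 * e * rdot c v +
    (- (K / 128 - K / 1024)) * (e * y / 2) + 3 * (K / 32 * e) ^+ 2 * em))%:E <= _)%E.
  apply: ae_le_mean mh _.
  - by apply: measurable_potU; exact: measurable_next.
  - by move=> w; exact: potU_ge0.
  - have aec := ae_offsupport_le mu2P mu2g S0 iS t1 vS.
    apply: filterS2 (ae_resid st.1.1) aec => w rw cw.
    apply: le_trans (potU_step g0 K0 rw cw) _.
    rewrite -/X -/e -/v /h ler_wpM2l ?expR_ge0// mulNr lerD2l.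
    by apply: ler_wpM2l; [rewrite mulr_ge0// sqr_ge0 | exact: rm].
rewrite lee_fin -[leRHS]mulr1; apply: ler_wpM2l; first exact: potU_ge0.
rewrite cv0 mulr0 addr0 -addrA gerDl.
have e0 : 0 < e by exact: eta_gt0.
have y0 : 0 <= y by exact: ynorm_ge0.
have eyK : K * (e * g * y) <= 1 by exact: eta_y_le.
have k1 : 0 <= 3 * (K / 32 * e) ^+ 2 by apply: mulr_ge0; [exact: ler0n | exact: sqr_ge0].
have le1 := ler_wpM2l k1 emle.
have k2 : 0 <= K * e * y by apply: mulr_ge0 => //; apply: mulr_ge0; exact: ltW.
have le2 := ler_wpM2l k2 eyK.
rewrite -/(ynorm S z st.1.1) -/y in le1.
by rewrite !expr2 in le1 *; clearbody e y; lra.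
Qed.

End drift.

(** * Probability of failure *)

Section sampled_blocks.
Context {R : realType} {n m : nat}.
Context {d0 : measure_display} {T0 : measurableType d0} {P0 : probability T0 R}.
Context {d : measure_display} {T : measurableType d} {P : probability T R}.
Variables (B : {RV P0 >-> blockType R n}) (Bs : 'I_m -> {RV P >-> blockType R n}).
Local Notation C := R[i].

(** Junk value [point] beyond the [m] available blocks. *)
Definition block_seq (k : nat) (w : T) : blockType R n :=
  if insub k is Some j then Bs j w else point.

Lemma block_seqE (j : 'I_m) w : block_seq j w = Bs j w.
Proof. by rewrite /block_seq valK. Qed.

Lemma measurable_block_seq k : measurable_fun setT (block_seq k).
Proof. by rewrite /block_seq; case: insub => [j|]; [exact: measurable_funPT | exact: measurable_cst]. Qed.

Lemma box_block_seq : iid_copies Bs B -> forall E : nat -> set (blockType R n),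
  (forall k, measurable (E k)) ->
  (P (box m block_seq E) = \prod_(k < m) distribution P0 B (E k))%E.
Proof.
move=> [ind same] E mE.
have -> : box m block_seq E = \bigcap_(k in [set: 'I_m]) Bs k @^-1` E k.
  apply/seteqP; split => w h k.
    by move=> _; have := h k (ltn_ord k); rewrite /= block_seqE.
  by move=> /= km; have := h (Ordinal km) Logic.I; rewrite /= -block_seqE.
rewrite (ind (fun k : 'I_m => E k))//; apply: eq_bigr => k _.
exact: (same k (E k) (mE k)).
Qed.

Variables (S : {set 'I_n}) (z : 'cV[C]_n) (g K : R).
Hypothesis g0 : 0 < g.
Hypothesis K0 : 0 < K.

Definition final_state (w : T) : gstateM R n :=
  gtraj S z g K (fun k => gram (block_val (block_seq k w))) m.

Let F (vb : gstateM R n * blockType R n) : gstateM R n :=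
  gstep S z g K vb.1 (gram (block_val vb.2)).

Let measurable_F : measurable_fun setT F.
Proof.
apply: (measurable_gstep S z g0 K0 (X := fst)); first exact: measurable_fst.
move=> i j; have [m1 m2] := @mxmeas_gram R n i j.
by split; [apply: (measurableT_comp m1) | apply: (measurableT_comp m2)].
Qed.

Let final_stateE w : final_state w =
  chain block_seq F (gstart S : gstateM R n) m w.
Proof.
rewrite /final_state; elim: m => [//|k IH] /=.
by rewrite IH.
Qed.

Lemma measurable_final_state : measurable_fun setT final_state.
Proof.
rewrite (_ : final_state = chain block_seq F (gstart S : gstateM R n) m).
  by apply: measurable_chain => //; exact: measurable_block_seq.
by apply/funext => w; rewrite final_stateE.
Qed.

Lemma expectation_final_le (Psi : gstateM R n -> R) rho : iid_copies Bs B ->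
  measurable_fun setT Psi -> (forall v, 0 <= Psi v) -> 0 <= rho ->
  (forall v, \int[P0]_w (Psi (gstep S z g K v (gram (block_val (B w)))))%:E <=
    (rho * Psi v)%:E)%E ->
  (\int[P]_w (Psi (final_state w))%:E <= (rho ^+ m * Psi (gstart S))%:E)%E.
Proof.
move=> iid mPsi Psi0 rho0 drift.
under eq_integral do rewrite final_stateE.
apply: (@expectation_chain_le _ _ _ _ _ _ _ P (distribution P0 B) m block_seq F
  (gstart S) measurable_block_seq measurable_F (box_block_seq iid) Psi rho m
  mPsi Psi0 rho0 _ (leqnn m)) => v.
rewrite ge0_integral_distribution; [exact: drift| |].
  apply/measurable_EFinP; apply: measurableT_comp => //.
  exact: measurable_fun_pair2 measurable_F.
by move=> b; rewrite lee_fin.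
Qed.

End sampled_blocks.

(** * Nonnegative variables with bounded mean, and Markov's inequality *)

Section mean_bounds.
Context {R : realType} {d : measure_display} {T : measurableType d}.
Variable P : probability T R.
Local Open Scope ereal_scope.

Definition mean_le (f : T -> R) (e : R) : Prop :=
  [/\ measurable_fun setT f, (forall w, 0 <= f w)%R &
      \int[P]_w (f w)%:E <= e%:E].

Lemma mean_leD f h e r : mean_le f e -> mean_le h r ->
  mean_le (fun w => f w + h w)%R (e + r)%R.
Proof.
move=> [mf f0 fe] [mh h0 hr]; split; first exact: measurable_funD.
  by move=> w; rewrite addr_ge0.
under eq_integral do rewrite EFinD.
rewrite ge0_integralD//; first by rewrite EFinD leeD.
- by move=> w _; rewrite lee_fin.
- exact/measurable_EFinP.
- by move=> w _; rewrite lee_fin.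
- exact/measurable_EFinP.
Qed.

Lemma mean_leZ f e k : (0 <= k)%R -> mean_le f e ->
  mean_le (fun w => k * f w)%R (k * e)%R.
Proof.
move=> k0 [mf f0 fe]; split; first exact: measurable_funM.
  by move=> w; rewrite mulr_ge0.
under eq_integral do rewrite EFinM.
rewrite ge0_integralZl//; first by rewrite EFinM lee_wpmul2l// lee_fin.
- exact/measurable_EFinP.
- by move=> w _; rewrite lee_fin.
Qed.

Lemma mean_le0 : mean_le (fun _ => 0%R) 0%R.
Proof. by split => //; rewrite integral0. Qed.

Lemma mean_le_sum (I : Type) (s : seq I) (Q : pred I) (f : I -> T -> R)
    (e : I -> R) :
  (forall i, Q i -> mean_le (f i) (e i)) ->
  mean_le (fun w => \sum_(i <- s | Q i) f i w)%R (\sum_(i <- s | Q i) e i)%R.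
Proof.
move=> fe; elim: s => [|i s IH].
  by rewrite big_nil; under eq_fun do rewrite big_nil; exact: mean_le0.
rewrite big_cons; under eq_fun do rewrite big_cons.
by case: ifP => // Qi; exact: mean_leD (fe i Qi) IH.
Qed.

Lemma mean_le_monotone f e r : (e <= r)%R -> mean_le f e -> mean_le f r.
Proof.
by move=> er [mf f0 fe]; split => //; apply: le_trans fe _; rewrite lee_fin.
Qed.

Lemma mean_le_probability f e : mean_le f e ->
  (1 - e)%:E <= P [set w | (f w < 1)%R].
Proof.
move=> [mf f0 fe]; have := markov_le mf f0 ltr01 fe; rewrite divr1 => le1.
have mA : measurable [set w | (1 <= f w)%R].
  rewrite -[X in measurable X]setTI -[X in _ `&` X]/(f @^-1` [set r | 1 <= r]%R).
  by rewrite -set_itvcy; apply: mf => //; exact: measurable_itv.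
have -> : [set w | (f w < 1)%R] = ~` [set w | (1 <= f w)%R].
  by apply/seteqP; split => w /=; rewrite ltNge => /negP.
rewrite probability_setC// EFinB; apply: leeB => //.
Qed.

End mean_bounds.

(** * Numerical bounds on logarithms *)

Section numerics.
Context {R : realType}.

(** This bound on [ln (4 n)] and the next one on [ln (12 / eps)] let the product of the two
    logarithms dominate their sum. *)
Lemma ln_ge_1_of_ge4 (a : R) : 4 <= a -> 1 <= ln a.
Proof.
move=> a4; rewrite -ler_expR lnK ?posrE; last by apply: lt_le_trans a4.
apply: le_trans a4.
have := expR_ge1Dx (- 2^-1 : R); rewrite expRN => h.
have e0 := expR_gt0 (2^-1 : R).
have h2 : expR (2^-1 : R) <= 2.
  have : (1 + - 2^-1) * expR (2^-1 : R) <= 1 by rewrite -ler_pdivlMr// mul1r.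
  lra.
have -> : expR (1 : R) = expR 2^-1 ^+ 2 by rewrite -expRM_natl mulfV.
have := ler_pM (ltW e0) (ltW e0) h2 h2; rewrite expr2; lra.
Qed.

Lemma ln_ge_2_of_ge12 (a : R) : 12 <= a -> 2 <= ln a.
Proof.
move=> a4; rewrite -ler_expR lnK ?posrE; last by apply: lt_le_trans a4.
apply: le_trans a4.
have := expR_ge1Dx (- 4^-1 : R); rewrite expRN => h.
have e0 := expR_gt0 (4^-1 : R).
set e := expR 4^-1 in h e0.
have h2 : e <= 4 / 3.
  have : (1 + - 4^-1) * e <= 1 by rewrite -ler_pdivlMr// mul1r.
  lra.
have -> : expR (2 : R) = ((e ^+ 2) ^+ 2) ^+ 2.
  by rewrite -!exprM -expRM_natl; congr expR; field.
have a1 : e ^+ 2 <= 16 / 9.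
  by have := ler_pM (ltW e0) (ltW e0) h2 h2; rewrite expr2; lra.
have s1 := sqr_ge0 e; move: (e ^+ 2) a1 s1 => b a1 s1.
have a2 : b ^+ 2 <= 32 / 10.
  by have := ler_pM s1 s1 a1 a1; rewrite expr2; lra.
have s2 := sqr_ge0 b; move: (b ^+ 2) a2 s2 => c a2 s2.
by have := ler_pM s2 s2 a2 a2; rewrite expr2; lra.
Qed.

End numerics.

Lemma unique_l1_solution_supp0 (R : realType) (n p : nat) (A : 'M[R[i]]_(p, n))
    (S : {set 'I_n}) (x : 'cV[R[i]]_n) : #|S| = 0%N -> supported_on S x ->
  is_unique_l1_solution A (A *m x) x.
Proof.
move=> /eqP; rewrite cards_eq0 => /eqP S0 xS.
have x0 : x = 0 by apply/colP => i; rewrite (xS i) ?mxE// S0 inE.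
have n0 : l1norm (0 : 'cV[R[i]]_n) = 0.
  by apply: big1 => i _; rewrite mxE Normc.normc0.
rewrite x0; split; first split => // z' _.
  by rewrite n0; apply: sumr_ge0 => i _; exact: normc_ge0.
move=> z [_ /(_ 0 erefl)]; rewrite n0 => z0.
apply: l2norm_eq0; apply/eqP; rewrite eq_le l2norm_ge0 andbT.
exact: le_trans (l2norm_le_l1norm z) z0.
Qed.

Lemma unique_l1_solution_of_lt (R : realType) (n p : nat) (A : 'M[R[i]]_(p, n))
    (x : 'cV[R[i]]_n) :
  (forall h, A *m h = 0 -> h != 0 -> l1norm x < l1norm (x + h)) ->
  is_unique_l1_solution A (A *m x) x.
Proof.
move=> lt; have key z : A *m z = A *m x -> z != x -> l1norm x < l1norm z.
  move=> Az zx; have := lt (z - x); rewrite [x + _]addrC subrK; apply.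
    by rewrite mulmxBr Az subrr.
  by rewrite subr_eq0.
split; first split => // z Az.
  by have [->//|zx] := eqVneq z x; exact: ltW (key z Az zx).
move=> z [Az zmin]; apply/eqP; apply: contraT => zx.
by have := zmin x erefl; rewrite leNgt key.
Qed.

Lemma sampling_mx_ker (R : realType) (n m : nat) (b : 'I_m -> blockType R n)
    (h : 'cV[R[i]]_n) : (0 < m)%N -> sampling_mx b *m h = 0 ->
  forall k, block_val (b k) *m h = 0.
Proof.
move=> m0; rewrite /sampling_mx -scalemxAl => /eqP; rewrite scaler_eq0.
case/orP => [|/eqP].
  rewrite -(rmorph0 (real_complex R)) => /eqP/complexI/eqP.
  by rewrite invr_eq0 sqrtr_eq0 leNgt ltr0n m0.
rewrite mxcol_mul => h0 k.
by have := congr1 (fun M => submxcol M k) h0; rewrite mxcolK submxcol0.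
Qed.

(** * Deterministic conditions read off from small potentials *)

Section good_state.
Context {R : realType} {n : nat}.
Local Notation C := R[i].
Variables (S : {set 'I_n}) (z : 'cV[C]_n) (K : R).
Hypothesis K0 : 0 < K.

(** At height 1/2 the linear exponent is already [K / 32 * 1/2 = K / 64], and the [ynorm] term only
    adds to it. *)
Lemma potU_lt c (st : @gstate R n) :
  expR (- (K / 64)) * potU S z K c st < 1 -> rdot c st.1.1 < 2^-1.
Proof.
rewrite /potU -expRD -[ltRHS]expR0 ltr_expR => lt0.
have y0 : 0 <= K / 128 * ynorm S z st.1.1.
  by rewrite mulr_ge0 ?ynorm_ge0// divr_ge0// ltW.
rewrite -(@ltr_pM2l _ (K / 32)) ?divr_gt0//; lra.
Qed.


(** The four directions bound both signs of the real and imaginary parts by 1/2, hence the modulus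
    by [1 / sqrt 2], which is below 3/4. *)
Definition sumU (i : 'I_n) (st : @gstate R n) : R :=
  potU S z K (1 *: unitv i) st + potU S z K (- 1 *: unitv i) st +
  potU S z K ('i *: unitv i) st + potU S z K (- 'i *: unitv i) st.

Lemma rdot_dir (t : C) i (u : 'cV[C]_n) : rdot (t *: unitv i) u =
  complex.Re t * complex.Re (u i 0) + complex.Im t * complex.Im (u i 0).
Proof.
rewrite /rdot (bigD1 i)//= !mxE !eqxx mulr1 big1 ?addr0// => k ki.
by rewrite !mxE (negbTE ki) mulr0 !mul0r addr0.
Qed.

Lemma sumU_lt i st : expR (- (K / 64)) * sumU i st < 1 ->
  Normc.normc (st.1.1 i 0) <= 3 / 4.
Proof.
move=> h; have p c : 0 <= expR (- (K / 64)) * potU S z K c st.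
  by rewrite mulr_ge0 ?expR_ge0.
have h1 : rdot (1 *: unitv i) st.1.1 < 2^-1.
  apply: potU_lt; apply: le_lt_trans h; rewrite /sumU !mulrDr.
  by rewrite -!addrA lerDl !addr_ge0.
have h2 : rdot (- 1 *: unitv i) st.1.1 < 2^-1.
  apply: potU_lt; apply: le_lt_trans h; rewrite /sumU !mulrDr.
  by rewrite addrAC [leRHS]addrAC -!addrA addrCA lerDl !addr_ge0.
have h3 : rdot ('i *: unitv i) st.1.1 < 2^-1.
  apply: potU_lt; apply: le_lt_trans h; rewrite /sumU !mulrDr.
  by rewrite [leRHS]addrAC lerDr !addr_ge0.
have h4 : rdot (- 'i *: unitv i) st.1.1 < 2^-1.
  apply: potU_lt; apply: le_lt_trans h; rewrite /sumU !mulrDr.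
  by rewrite lerDr !addr_ge0.
move: h1 h2 h3 h4; rewrite !rdot_dir /=.
rewrite -(@ler_pXn2r _ 2)// ?nnegrE ?normc_ge0// normc_sqr.
move: (complex.Re _) (complex.Im _) => a b h1 h2 h3 h4.
have : 0 <= (2^-1 - a) * (2^-1 + a) by apply: mulr_ge0; lra.
have : 0 <= (2^-1 - b) * (2^-1 + b) by apply: mulr_ge0; lra.
rewrite !expr2; lra.
Qed.

End good_state.

(** The weights yield [M <= q^-2] and a Frobenius norm of [Q] at most [q^3], so the product required
    by [golfing_recovery] is at most [2 n q <= 1/24]. *)
Lemma golfing_succeeds (R : realType) (n N : nat) (S : {set 'I_n})
    (x h : 'cV[R[i]]_n) (g K q : R) (p : nat -> nat)
    (B : forall k, 'M[R[i]]_(p k, n)) :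
  let st := gtraj S (sgnv x) g K (fun k => gram (B k)) N in
  0 < g -> 0 < K -> 0 < q -> (48 * n%:R) * q <= 1 -> (0 < n)%N ->
  supported_on S x ->
  \sum_(i in ~: S) expR (- (K / 64)) * sumU S (sgnv x) K i st +
    (q ^+ 6)^-1 * potQ S (sgnv x) K st + q ^+ 2 * potC S st < 1 ->
  (forall k, (k < N)%N -> B k *m h = 0) -> h != 0 ->
  l1norm x < l1norm (x + h).
Proof.
move=> st g0 K0 q0 nq n0 xS small Bh hN0.
have pU i : 0 <= expR (- (K / 64)) * sumU S (sgnv x) K i st.
  by rewrite mulr_ge0 ?expR_ge0// !addr_ge0 ?potU_ge0.
have pUs : 0 <= \sum_(i in ~: S) expR (- (K / 64)) * sumU S (sgnv x) K i st.
  by apply: sumr_ge0.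
have pQ : 0 <= (q ^+ 6)^-1 * potQ S (sgnv x) K st.
  by rewrite mulr_ge0 ?potQ_ge0// invr_ge0 exprn_ge0// ltW.
have pC : 0 <= q ^+ 2 * potC S st.
  by rewrite mulr_ge0 ?potC_ge0// exprn_ge0// ltW.
have prjQ : prj S *m st.1.2 = st.1.2 by exact: prj_gtraj.
have n1 : 1 <= n%:R :> R by rewrite ler1n.
have q1 : q <= 48^-1.
  have : 1 * q <= n%:R * q by rewrite ler_wpM2r// ltW.
  by move=> qn; rewrite -[leRHS]mul1r ler_pdivlMr ?ltr0n//; lra.
have Mlt : st.2 <= (q ^+ 2)^-1.
  have : q ^+ 2 * potC S st < 1 by lra.
  rewrite -ltr_pdivlMl ?exprn_gt0// mulr1 => Cq; apply: ltW; apply: le_lt_trans Cq.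
  apply: le_trans (ler_norm _) _.
  by rewrite /potC lerDl !mulr_ge0 ?sqrtr_ge0 ?ler0n.
have Qlt : Num.sqrt (frob st.1.2) <= q ^+ 3.
  have : (q ^+ 6)^-1 * potQ S (sgnv x) K st < 1 by lra.
  rewrite -ltr_pdivlMl ?invr_gt0 ?exprn_gt0// invrK mulr1 => Qq.
  rewrite -[leRHS](ger0_norm (exprn_ge0 3 (ltW q0))) -sqrtr_sqr.
  apply: ler_wsqrtr; rewrite -exprM; apply: ltW; apply: le_lt_trans Qq.
  rewrite /potQ prjQ ler_peMr ?frob_ge0//.
  by rewrite -[leLHS]expR0 ler_expR mulr_ge0 ?ynorm_ge0// mulr_ge0// ltW.
have M0 : 0 <= st.2 by apply: gtraj_ge0; exact: ltW.
have sn : Num.sqrt #|S|%:R <= n%:R :> R.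
  rewrite -[leRHS](ger0_norm (ler0n R n)) -sqrtr_sqr; apply: ler_wsqrtr.
  rewrite -natrX ler_nat (leq_trans (max_card _))// card_ord.
  by rewrite -{1}[n]expn1 leq_pexp2l.
have q2 : q ^+ 2 <= 1 by rewrite exprn_ile1 ?(ltW q0)//; lra.
apply: (golfing_recovery (ltW g0) (ltW K0) xS _ _ _ Bh hN0).
- move=> i iS; apply: (sumU_lt K0 (S := S) (z := sgnv x)).
  apply: le_lt_trans small; rewrite (bigD1 i) ?inE//= -!addrA lerDl.
  by rewrite !addr_ge0// sumr_ge0.
- apply: le_trans Qlt _; rewrite exprSr.
  have := ler_pM (sqr_ge0 q) (ltW q0) q2 q1; lra.
- have : 2 * st.2 * Num.sqrt (frob st.1.2) * Num.sqrt #|S|%:R <=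
      2 * (q ^+ 2)^-1 * q ^+ 3 * n%:R.
    apply: ler_pM => //; rewrite ?sqrtr_ge0 ?mulr_ge0 ?sqrtr_ge0//.
    apply: ler_pM => //; rewrite ?sqrtr_ge0 ?mulr_ge0//.
    by rewrite ler_wpM2l.
  have -> : 2 * (q ^+ 2)^-1 * q ^+ 3 * n%:R = 2 * (n%:R * q).
    by field; rewrite lt0r_neq0.
  move=> /le_trans; apply; lra.
Qed.

Section failure_probability.
Context {R : realType} {n m : nat}.
Context {d0 : measure_display} {T0 : measurableType d0} {P0 : probability T0 R}.
Context {d : measure_display} {T : measurableType d} {P : probability T R}.
Variables (B : {RV P0 >-> blockType R n}) (Bs : 'I_m -> {RV P >-> blockType R n}).
Variables (S : {set 'I_n}) (x : 'cV[R[i]]_n) (mu1 mu2 mu3 g K q : R).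
Hypothesis iid : iid_copies Bs B.
Hypothesis isoB : isotropic B.
Hypothesis mu1P : is_mu1 B S mu1.
Hypothesis mu2P : is_mu2 B S mu2.
Hypothesis mu3P : is_mu3 B S mu3.
Hypothesis mu1g : mu1 <= g.
Hypothesis mu2g : mu2 <= g.
Hypothesis mu3g : mu3 <= g.
Hypothesis S0 : (0 < #|S|)%N.
Hypothesis xS : supported_on S x.
Hypothesis K0 : 0 < K.
Hypothesis q0 : 0 < q.
Let z := sgnv x.
Let st (w : T) : gstateM R n := final_state Bs S z g K w.

Let g1 : 1 <= g. Proof. exact: (gamma_ge1 isoB mu1P mu1g S0). Qed.
Let g0 : 0 < g. Proof. exact: lt_le_trans ltr01 g1. Qed.

Let ynorm_start : ynorm S z 0 <= 1.
Proof.
rewrite /ynorm /resid subr0 (prj_sgnv xS) ler_pdivrMr ?sqrtr_gt0 ?ltr0n//.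
by rewrite mul1r l2norm_rdot ler_wsqrtr// sgnv_le.
Qed.

Let card_S_le : #|S|%:R <= n%:R :> R.
Proof. by rewrite ler_nat (leq_trans (max_card _))// card_ord. Qed.

Let frob_start : frob (prj S *m prj S : 'M[R[i]]_n) = #|S|%:R.
Proof. by rewrite prjK frob_prj. Qed.

Let measurable_st : measurable_fun setT st.
Proof. exact: measurable_final_state. Qed.

Lemma mean_le_potU i t : i \notin S -> Normc.normc t = 1 ->
  mean_le P (fun w => potU S z K (t *: unitv i) (st w)) (expR (K / 128)).
Proof.
move=> iS t1; split; [exact: measurable_potU|by move=> w; exact: potU_ge0|].
have := expectation_final_le g0 K0 iid (S := S) (z := z)
  (@measurable_potU R n S z K _ _ id (@measurable_id _ _ _) (t *: unitv i))
  (fun v => potU_ge0 S K z (t *: unitv i) v) ler01.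
move=> /(_ _)/le_trans; apply.
  move=> v; rewrite mul1r.
  exact: (drift_potU z isoB mu1P mu2P mu3P mu1g mu2g mu3g S0 K0).
rewrite expr1n mul1r lee_fin ler_expR /= rdot0r mulr0 add0r.
by rewrite ler_piMr// divr_ge0// ltW.
Qed.

Lemma mean_le_potQ : mean_le P (fun w => potQ S z K (st w))
  ((1 - (4 * g)^-1) ^+ m * (n%:R * expR (2 * K))).
Proof.
split; [exact: measurable_potQ|by move=> w; exact: potQ_ge0|].
have rho0 : 0 <= 1 - (4 * g)^-1.
  by rewrite subr_ge0 invf_le1 ?mulr_gt0//; have := g1; lra.
have := expectation_final_le g0 K0 iid (S := S) (z := z)
  (@measurable_potQ R n S z K _ _ id (@measurable_id _ _ _))
  (fun v => potQ_ge0 S K z v) rho0.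
move=> /(_ _)/le_trans; apply.
  move=> v; exact: (drift_potQ z isoB mu1P mu1g S0 K0).
rewrite lee_fin ler_wpM2l ?exprn_ge0// /potQ /= frob_start.
rewrite ler_pM ?expR_ge0 ?ler0n// ler_expR.
by rewrite ler_piMr// mulr_ge0// ltW.
Qed.

Lemma mean_le_potC : mean_le P (fun w => potC S (st w)) (2 * n%:R * n%:R).
Proof.
split; [exact: measurable_potC|by move=> w; exact: potC_ge0|].
have := expectation_final_le g0 K0 iid (S := S) (z := z)
  (@measurable_potC R n S _ _ id (@measurable_id _ _ _))
  (fun v => potC_ge0 S v) ler01.
move=> /(_ _)/le_trans; apply.
  move=> v; rewrite mul1r; exact: (drift_potC z isoB mu1P mu1g S0 K0).
rewrite expr1n mul1r lee_fin /potC /= frob_start normr0 add0r.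
rewrite ler_wpM2l ?mulr_ge0 ?ler0n//.
have s1 : 1 <= #|S|%:R :> R by rewrite ler1n.
apply: le_trans card_S_le; rewrite -[leRHS]ger0_norm ?ler0n// -sqrtr_sqr.
by apply: ler_wsqrtr; rewrite expr2 ler_peMl ?ler0n.
Qed.

(** A single nonnegative variable whose being [< 1] makes all the deterministic
    requirements hold, so that one application of Markov's inequality replaces a
    union bound. *)
Definition failure (w : T) : R :=
  \sum_(i in ~: S) expR (- (K / 64)) * sumU S z K i (st w) +
  (q ^+ 6)^-1 * potQ S z K (st w) + q ^+ 2 * potC S (st w).

(** Initially [ynorm] is at most 1, so each [potU] has mean at most [exp (K / 128)]; the weight
    [exp (- K / 64)] turns it into [exp (- K / 128)], for four directions and at most [n]
    entries. *)
Lemma mean_le_failure : mean_le P failure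
  (4 * n%:R * expR (- (K / 128)) +
   (q ^+ 6)^-1 * ((1 - (4 * g)^-1) ^+ m * (n%:R * expR (2 * K))) +
   q ^+ 2 * (2 * n%:R * n%:R)).
Proof.
have nN1 : Normc.normc (- 1 : R[i]) = 1.
  by rewrite /= !sqrrN expr1n expr0n addr0 sqrtr1.
have nNi : Normc.normc (- 'i : R[i]) = 1.
  by rewrite /= !sqrrN expr1n expr0n add0r sqrtr1.
apply: mean_leD; last first.
  by apply: mean_leZ mean_le_potC; rewrite exprn_ge0// ltW.
apply: mean_leD; last first.
  by apply: mean_leZ mean_le_potQ; rewrite invr_ge0 exprn_ge0// ltW.
apply: (mean_le_monotone (e := \sum_(i in ~: S) 4 * expR (- (K / 128)))).
  rewrite sumr_const -[leLHS]mulr_natr mulrAC ler_wpM2r ?expR_ge0//.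
  by rewrite ler_wpM2l// ler_nat (leq_trans (max_card _))// card_ord.
apply: mean_le_sum => i; rewrite inE => iS.
have -> : 4 * expR (- (K / 128)) = expR (- (K / 64)) *
    (expR (K / 128) + expR (K / 128) + expR (K / 128) + expR (K / 128)).
  rewrite (_ : - (K / 64) = - (K / 128) + - (K / 128)); last by field.
  rewrite expRD expRN; field.
  by rewrite lt0r_neq0// expR_gt0.
apply: mean_leZ; first exact: expR_ge0.
by do 3 (apply: mean_leD; last by apply: mean_le_potU => //; exact: normc_i);
  apply: mean_le_potU => //; exact: Normc.normc1.
Qed.

Lemma failure_lt1_unique w : (0 < m)%N -> (48 * n%:R) * q <= 1 -> (0 < n)%N ->
  failure w < 1 ->
  let A := sampling_mx (fun k => Bs k w) in
  is_unique_l1_solution A (A *m x) x.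
Proof.
move=> m0 nq n0 fw A; apply: unique_l1_solution_of_lt => h Ah hN0.
apply: (golfing_succeeds (B := fun k => block_val (block_seq Bs k w)) g0 K0 q0 nq
  n0 xS fw) hN0 => k km.
have := sampling_mx_ker m0 Ah (Ordinal km).
by rewrite -block_seqE.
Qed.

End failure_probability.

Lemma failure_bound_le (R : realType) (n m : nat) (g eps : R) :
  let Lam := ln (4 * n%:R) + ln (12 * eps^-1) in
  let q := eps / (48 * n%:R) in
  (0 < n)%N -> 0 < eps < 1 -> 1 <= g ->
  (3 * 534)%:R * g * ln (4 * n%:R) * ln (12 * eps^-1) <= m%:R ->
  [/\ 0 < Lam, (0 < m)%N &
    4 * n%:R * expR (- (128 * Lam / 128)) +
    (q ^+ 6)^-1 * ((1 - (4 * g)^-1) ^+ m * (n%:R * expR (2 * (128 * Lam)))) +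
    q ^+ 2 * (2 * n%:R * n%:R) <= eps].
Proof.
move=> Lam q n0 /andP[e0 e1] g1 hm.
have np : 0 < n%:R :> R by rewrite ltr0n.
have n1 : 1 <= n%:R :> R by rewrite ler1n.
have ep : 0 < 12 * eps^-1 by rewrite mulr_gt0// invr_gt0.
have n4 : 0 < 4 * n%:R :> R by rewrite mulr_gt0.
have L1 : 1 <= ln (4 * n%:R) :> R by apply: ln_ge_1_of_ge4; lra.
have L2 : 2 <= ln (12 * eps^-1).
  apply: ln_ge_2_of_ge12; rewrite ler_peMr//.
  by rewrite invf_ge1// ltW.
have q0 : 0 < q by rewrite divr_gt0// mulr_gt0.
have qE : expR (- Lam) = q.
  rewrite expRN expRD !lnK ?posrE// /q; field.
  by rewrite !lt0r_neq0.
have nq : n%:R * q = eps / 48 by rewrite /q; field; rewrite lt0r_neq0.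
have q1 : q <= 1.
  by have := ler_wpM2r (ltW q0) n1; rewrite nq; lra.
rewrite natrM in hm.
move: (ln (4 * n%:R)) (ln (12 * eps^-1)) @Lam L1 L2 qE hm => a b Lam a1 b2 qE hm.
have gp : 0 < g by lra.
have ab0 : 0 <= (a - 1) * (b - 2) by rewrite mulr_ge0// subr_ge0.
have LamE : Lam = a + b by [].
have Lam0 : 0 < Lam by lra.
(* [3 a b - 2 (a + b) = 3 (a - 1) (b - 2) + 4 a + b - 6]. With this, [3 * 534 * g a b] is at least
   [534 * 2 * g Lam = 267 Lam * (4 g)]. *)
have abLam : 2 * Lam <= 3 * (a * b) by rewrite LamE; lra.
have mg : 267 * Lam * (4 * g) <= m%:R.
  have := ler_wpM2l (ltW gp) abLam.
  have : 0 <= g * (a * b) by rewrite !mulr_ge0//; lra.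
  by move: hm; clearbody Lam; lra.
have m0 : (0 < m)%N.
  rewrite -(ltr_nat R); apply: lt_le_trans mg.
  by rewrite !mulr_gt0.
split => //.
have h1 : 4 * n%:R * expR (- (128 * Lam / 128)) = eps / 12.
  have -> : 128 * Lam / 128 = Lam by field.
  by rewrite qE -mulrA nq; field.
(* Of the 267 multiples of [Lam], 256 pay for [exp (2 K)]; the other 11 leave [q^11], more than the
   weight [q^-6] consumes. *)
have h2 : (1 - (4 * g)^-1) ^+ m * expR (2 * (128 * Lam)) <= q ^+ 11.
  have rho0 : 0 <= 1 - (4 * g)^-1.
    by rewrite subr_ge0 invf_le1 ?mulr_gt0//; lra.
  have : (1 - (4 * g)^-1) ^+ m <= expR (- (m%:R / (4 * g))).
    rewrite -mulrN expRM_natl lerXn2r ?nnegrE ?expR_ge0//.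
    exact: expR_ge1Dx.
  move=> /(ler_wpM2r (expR_ge0 (2 * (128 * Lam)))) /le_trans; apply.
  rewrite -qE -expRM_natl -expRD ler_expR.
  have : 267 * Lam <= m%:R / (4 * g) by rewrite ler_pdivlMr ?mulr_gt0.
  by clearbody Lam; lra.
have h3 : (q ^+ 6)^-1 * ((1 - (4 * g)^-1) ^+ m * (n%:R * expR (2 * (128 * Lam))))
    <= eps / 48.
  rewrite -nq [X in _ * X <= _]mulrCA [leLHS]mulrCA ler_wpM2l ?(ltW np)//.
  rewrite -ler_pdivlMl ?invr_gt0 ?exprn_gt0// invrK.
  apply: le_trans h2 _; rewrite -exprSr.
  by apply: ler_wiXn2l => //; rewrite ltW.
have h4 : q ^+ 2 * (2 * n%:R * n%:R) <= eps / 4.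
  have -> : q ^+ 2 * (2 * n%:R * n%:R) = 2 * (n%:R * q) * (n%:R * q) by ring.
  rewrite nq; have : eps * eps <= 1 * eps by rewrite ler_wpM2r// ltW.
  lra.
by rewrite h1; lra.
Qed.

Theorem theorem3p1 (R : realType) (n m : nat)
    (S : {set 'I_n}) (x : 'cV[R[i]]_n) (eps : R)
    (d0 : measure_display) (T0 : measurableType d0) (P0 : probability T0 R)
    (B : {RV P0 >-> blockType R n})
    (d : measure_display) (T : measurableType d) (P : probability T R)
    (Bs : 'I_m -> {RV P >-> blockType R n})
    (mu1 mu2 mu3 : R) :
  supported_on S x ->
  0 < eps < 1 ->
  iid_copies Bs B ->
  isotropic B ->
  is_mu1 B S mu1 -> is_mu2 B S mu2 -> is_mu3 B S mu3 ->
  m%:R >= (3 * 534)%:R * Num.max mu1 (Num.max mu2 mu3)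
            * ln (4 * n%:R) * ln (12 * eps^-1) ->
  with_probability_ge P (1 - eps) (fun w =>
    let A := sampling_mx (fun k => Bs k w) in
    is_unique_l1_solution A (A *m x) x).
Proof.
move=> xS eps01 iid isoB mu1P mu2P mu3P.
(* For empty [S] the three coherences are 0 and [m] may be 0, but then [x = 0], the only vector of
   norm 0. *)
have [S0|S0] := posnP #|S|.
  move=> _; exists setT; split => //.
    rewrite [leRHS](@probability_setT _ _ _ P) lee_fin.
    by case/andP: eps01 => ? _; lra.
  by move=> w _; apply: unique_l1_solution_supp0 S0 xS.
set g := Num.max _ _ => hm.
have mu1g : mu1 <= g by rewrite /g le_max lexx.
have mu2g : mu2 <= g by rewrite /g !le_max lexx orbT.
have mu3g : mu3 <= g by rewrite /g !le_max lexx !orbT.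
have n0 : (0 < n)%N by rewrite -[n]card_ord (leq_trans S0)// max_card.
have g1 : 1 <= g by exact: (gamma_ge1 isoB mu1P mu1g S0).
have [Lam0 m0 bound] := failure_bound_le n0 eps01 g1 hm.
set Lam := ln _ + ln _ in Lam0 bound.
pose K := 128 * Lam; pose q := eps / (48 * n%:R).
have K0 : 0 < K by rewrite mulr_gt0.
have np : 0 < n%:R :> R by rewrite ltr0n.
have [e0 e1] : 0 < eps /\ eps < 1 by case/andP: eps01.
have q0 : 0 < q by rewrite divr_gt0// mulr_gt0.
have nq : (48 * n%:R) * q <= 1.
  by rewrite /q mulrC divfK ?(ltW e1)// lt0r_neq0// mulr_gt0.
have mle := mean_le_monotone bound
  (mean_le_failure iid isoB mu1P mu2P mu3P mu1g mu2g mu3g S0 xS K0 q0).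
exists [set w | failure Bs S x g K q w < 1]; split.
- case: mle => mf _ _; rewrite -[X in measurable X]setTI.
  rewrite -[X in _ `&` X]/(failure Bs S x g K q @^-1` [set r | r < 1]).
  by rewrite -set_itvNyo; apply: mf => //; exact: measurable_itv.
- exact: mean_le_probability mle.
- move=> w fw; exact: (failure_lt1_unique isoB mu1P mu1g S0 xS K0 q0 m0 nq n0 fw).
Qed.
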